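(* The norm of the Hilbert matrix operator $\mathcal{H}$ acting from the Bloch space $\mathcal{B}$ into the logarithmically weighted Bloch space $\mathcal{B}_{\log}$ satisfies $$\|\mathcal{H}\|_{\mathcal{B}\to\mathcal{B}_{\log}}=\frac{3}{2}.$$
   Context: Let $\mathbb{D}$ be the open unit disk of $\mathbb{C}$ and $H(\mathbb{D})$ the set of all analytic functions in $\mathbb{D}$. For $f(z)=\sum_{k=0}^\infty a_kz^k\in H(\mathbb{D})$, the Hilbert matrix operator is defined by $$\mathcal{H}f(z)=\sum_{n=0}^\infty\left(\sum_{k=0}^\infty\frac{a_k}{n+k+1}\right)z^n,$$ whenever the right-hand side makes sense (the inner series converging as ordinary limits of partial sums) and defines an analytic function in $\mathbb{D}$. The Bloch space $\mathcal{B}$ consists of all $f\in H(\mathbb{D})$ with $$\|f\|_{\mathcal{B}}=|f(0)|+\sup_{z\in\mathbb{D}}(1-|z|^2)|f'(z)|<\infty.$$ The logarithmically weighted Bloch space $\mathcal{B}_{\log}$ consists of all $f\in H(\mathbb{D})$ with $$\|f\|_{\mathcal{B}_{\log}}=|f(0)|+\sup_{z\in\mathbb{D}}\left(\log\frac{e}{(1-|z|)^2}\right)^{-1}(1-|z|^2)|f'(z)|<\infty.$$ The operator norm is $\|\mathcal{H}\|_{\mathcal{B}\to\mathcal{B}_{\log}}=\sup\{\|\mathcal{H}f\|_{\mathcal{B}_{\log}}/\|f\|_{\mathcal{B}}: 0\ne f\in\mathcal{B}\}$. *)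

(* Defs.v *)
From Stdlib Require Import Reals.
From Coquelicot Require Import Coquelicot.
Open Scope R_scope.

(* Functions on the open unit disk are represented by total functions C -> C;
   every notion below only depends on the values taken on the disk. *)

Definition disk (z : C) : Prop := Cmod z < 1.

Definition analytic_on_disk (f : C -> C) : Prop :=
  forall z0 : C, disk z0 ->
    exists (a : nat -> C) (r : R), 0 < r /\
      forall z : C, Cmod (z - z0)%C < r -> is_pseries a (z - z0)%C (f z).

Definition power_series_on_disk (a : nat -> C) (f : C -> C) : Prop :=
  forall z : C, disk z -> is_pseries a z (f z).

(* [is_hilbert f g] reads: the Hilbert matrix operator is defined at f, and
   its value there is g.  It includes the convergence of every inner series
   and the convergence of the outer power series on the whole disk, i.e. the
   fact that it defines an analytic function there. *)
Definition is_hilbert (f g : C -> C) : Prop :=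
  exists a b : nat -> C,
    power_series_on_disk a f /\
    (forall n : nat,
       is_series (fun k : nat => (a k / RtoC (INR (n + k + 1)))%C) (b n)) /\
    power_series_on_disk b g.

(* The norms take values in the extended reals, so that an unbounded supremum
   gives [p_infty]. *)

Definition bloch_norm (f : C -> C) : Rbar :=
  Rbar_plus (Cmod (f (RtoC 0)))
    (Lub_Rbar (fun x : R => exists z : C, disk z /\
       x = (1 - Cmod z ^ 2) * Cmod (C_derive f z))).

Definition bloch_log_norm (f : C -> C) : Rbar :=
  Rbar_plus (Cmod (f (RtoC 0)))
    (Lub_Rbar (fun x : R => exists z : C, disk z /\
       x = / ln (exp 1 / (1 - Cmod z) ^ 2) *
           ((1 - Cmod z ^ 2) * Cmod (C_derive f z)))).

Definition bloch (f : C -> C) : Prop :=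
  analytic_on_disk f /\ Rbar_lt (bloch_norm f) p_infty.

Definition bloch_log (f : C -> C) : Prop :=
  analytic_on_disk f /\ Rbar_lt (bloch_log_norm f) p_infty.

Definition nonzero_on_disk (f : C -> C) : Prop :=
  exists z : C, disk z /\ f z <> RtoC 0.

(* The supremum is taken in the extended reals: the quotient is [p_infty]
   whenever the numerator is. *)
Definition hilbert_norm_bloch_bloch_log : Rbar :=
  Rbar_lub (fun x : Rbar => exists f g : C -> C,
    bloch f /\ nonzero_on_disk f /\ is_hilbert f g /\
    x = Rbar_div (bloch_log_norm g) (bloch_norm f)).

(* Main.v *)
Require Import Defs.
From Stdlib Require Import Reals Arith Lra Lia Classical ClassicalEpsilon.
From mathcomp Require binomial.
From Coquelicot Require Import Coquelicot.
Open Scope R_scope.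

(** Write f(z) for the sum of a_k z^k, let beta be the supremum of (1 - |z|^2) |f'(z)|, and
    let g be the image of f, with coefficients b_n; formally b_n is the integral of t^n f(t)
    over the unit interval.

    Upper bound. On the radius, |f(t) - f(0)| is at most beta h(t) with
    h(t) = (ln (1+t) - ln (1-t)) / 2, so that b_n differs from a_0 / (n+1) by at most beta
    times the n-th moment of h, which is e_n / (n+1) with e_0 = ln 2, e_1 = 1 and
    e_(n+2) = e_n + 1/(n+2) ([hilbert_coef_bound]). For n = 0 this gives
    |g(0)| <= |f(0)| + beta ln 2. For the derivative, the reciprocal of the weight is
    (1 - 2 ln (1-x)) / (1 - x^2) with x = |z|, a power series with explicit positive
    coefficients, and (n+1) |b_(n+1)| is at most |f(0)|/2 + (3/2 - ln 2) beta times its n-th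
    coefficient ([constant_part_le], [bloch_part_le]). Hence the weighted derivative is at
    most |f(0)|/2 + (3/2 - ln 2) beta, and the two estimates add up to
    (3/2) (|f(0)| + beta).

    Lower bound. The constant function 1 has norm 1, and its image has g(0) = 1 and
    g'(0) = 1/2, where the weight is 1.

    Existence of the image. A Bloch function is given by local expansions, so a power series
    on the whole disk has to be found first ([analytic_power_series]), and then the inner
    series must converge. Both rest on Bessel's inequality on a circle, which is obtained
    without integration by averaging over roots of unity ([bessel_circle]). Its special case,
    Cauchy's estimate, lets an expansion be continued across its circle of convergence as
    long as that circle lies in the domain of analyticity ([expansion_extends]). Applied to
    f' on circles of radius close to 1, Bessel's inequality bounds the square means of
    k a_k well enough for the sum of |a_k| / (k+1) to be finite ([bloch_coef_summable]). That
    g is again analytic follows from recentering its power series ([taylor_pseries]). *)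

(** * Complex series *)
(* Equations produced by the hierarchy of algebraic structures live in a structure's
   carrier; [ring] and [field] only recognise them once the type is folded back. *)
Ltac real_eq := match goal with |- ?x = ?y => change (x = y :> R) end.
Ltac complex_eq := match goal with |- ?x = ?y => change (x = y :> C) end.

Lemma Re_sum_n (a : nat -> C) n : Re (sum_n a n) = sum_n (fun k => Re (a k)) n.
Proof.
  induction n as [|n IH]; [now rewrite !sum_O|].
  rewrite !sum_Sn, <- IH; reflexivity.
Qed.

Lemma Im_sum_n (a : nat -> C) n : Im (sum_n a n) = sum_n (fun k => Im (a k)) n.
Proof.
  induction n as [|n IH]; [now rewrite !sum_O|].
  rewrite !sum_Sn, <- IH; reflexivity.
Qed.

Lemma is_series_Re (a : nat -> C) (l : C) :
  is_series a l -> is_series (fun n => Re (a n)) (Re l).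
Proof.
  intros H. unfold is_series in *.
  apply filterlim_ext with (f := fun n => fst (sum_n a n)).
  { intros n; apply Re_sum_n. }
  eapply filterlim_comp; [exact H|].
  destruct l as [x y]. intros P [e He]; exists e; intros [u v] [Hu _]; now apply He.
Qed.

Lemma is_series_Im (a : nat -> C) (l : C) :
  is_series a l -> is_series (fun n => Im (a n)) (Im l).
Proof.
  intros H. unfold is_series in *.
  apply filterlim_ext with (f := fun n => snd (sum_n a n)).
  { intros n; apply Im_sum_n. }
  eapply filterlim_comp; [exact H|].
  destruct l as [x y]. intros P [e He]; exists e; intros [u v] [_ Hv]; now apply He.
Qed.

Lemma is_series_Re_Im (a : nat -> C) (l : C) :
  is_series (fun n => Re (a n)) (Re l) ->
  is_series (fun n => Im (a n)) (Im l) -> is_series a l.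
Proof.
  intros Hr Hi P [e He].
  specialize (Hr (fun x => ball (Re l) e x) (locally_ball _ e)).
  specialize (Hi (fun x => ball (Im l) e x) (locally_ball _ e)).
  unfold filtermap in *.
  generalize (filter_and _ _ Hr Hi); apply filter_imp.
  intros n [H1 H2]; apply He.
  rewrite <- Re_sum_n in H1; rewrite <- Im_sum_n in H2.
  split; assumption.
Qed.

Definition CSeries (a : nat -> C) : C :=
  (Series (fun n => Re (a n)), Series (fun n => Im (a n))).

Lemma CSeries_unique (a : nat -> C) l : is_series a l -> CSeries a = l.
Proof.
  intros H. destruct l as [x y]; unfold CSeries; f_equal; apply is_series_unique.
  - exact (is_series_Re _ _ H).
  - exact (is_series_Im _ _ H).
Qed.

Lemma is_Cseries_unique (a : nat -> C) (l l' : C) :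
  is_series a l -> is_series a l' -> l = l'.
Proof.
  intros H H'. now rewrite <- (CSeries_unique _ _ H), <- (CSeries_unique _ _ H').
Qed.

Lemma im_le_Cmod (c : C) : Rabs (Im c) <= Cmod c.
Proof.
  eapply Rle_trans; [apply Rmax_r|]; apply Rmax_Cmod.
Qed.

Lemma CSeries_correct (a : nat -> C) :
  ex_series (fun n => Cmod (a n)) -> is_series a (CSeries a).
Proof.
  intros H; apply is_series_Re_Im; apply Series_correct;
    (eapply (@ex_series_le R_AbsRing R_CompleteNormedModule); [|exact H]); intros n.
  - apply re_le_Cmod.
  - apply im_le_Cmod.
Qed.

Lemma Cmod_is_series_le (a : nat -> C) (l : C) (b : nat -> R) (L : R) :
  is_series a l -> is_series b L -> (forall n, Cmod (a n) <= b n) -> Cmod l <= L.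
Proof.
  intros Ha Hb Hab.
  assert (Hn : forall n, Cmod (sum_n a n) <= sum_n b n).
  { induction n as [|n IH]; [rewrite !sum_O; apply Hab|].
    rewrite !sum_Sn. eapply Rle_trans; [apply Cmod_triangle|].
    apply Rplus_le_compat; [exact IH|apply Hab]. }
  apply (filterlim_le (F := eventually) (fun n => norm (sum_n a n)) (sum_n b)
           (Cmod l) L).
  - apply filter_forall; intros n; apply Hn.
  - eapply filterlim_comp; [exact Ha|].
    exact (@filterlim_norm C_AbsRing C_NormedModule l).
  - exact Hb.
Qed.

Lemma is_Cseries_scal (c : C) (a : nat -> C) (l : C) :
  is_series a l -> is_series (fun n => (c * a n)%C) (c * l)%C.
Proof. exact (@is_series_scal C_AbsRing C_NormedModule c a l). Qed.

Lemma is_Cseries_minus (a b : nat -> C) (la lb : C) :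
  is_series a la -> is_series b lb -> is_series (fun n => (a n - b n)%C) (la - lb)%C.
Proof. exact (@is_series_minus C_AbsRing C_NormedModule a b la lb). Qed.

Lemma Csum_mult_l (c : C) (a : nat -> C) N :
  sum_n (fun k => (c * a k)%C) N = (c * sum_n a N)%C.
Proof. exact (sum_n_mult_l (K := C_Ring) c a N). Qed.

Lemma Rsum_mult_l (c : R) (a : nat -> R) N :
  sum_n (fun k => c * a k) N = c * sum_n a N.
Proof. exact (sum_n_mult_l (K := R_Ring) c a N). Qed.

Lemma Csum_Sn (a : nat -> C) N : sum_n a (S N) = (sum_n a N + a (S N))%C.
Proof. exact (sum_Sn a N). Qed.

Lemma Rsum_Sn (a : nat -> R) N : sum_n a (S N) = sum_n a N + a (S N).
Proof. exact (sum_Sn a N). Qed.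

Lemma Csum_ext (a b : nat -> C) N :
  (forall k, (k <= N)%nat -> a k = b k) -> sum_n a N = sum_n b N :> C.
Proof. exact (sum_n_ext_loc a b N). Qed.

Lemma Rsum_ext (a b : nat -> R) N :
  (forall k, (k <= N)%nat -> a k = b k) -> sum_n a N = sum_n b N :> R.
Proof. exact (sum_n_ext_loc a b N). Qed.

Lemma Csum_0 N : sum_n (fun _ => RtoC 0) N = RtoC 0 :> C.
Proof.
  induction N as [|N IH]; [apply sum_O|]. rewrite Csum_Sn, IH. ring.
Qed.

Lemma sum_n_nonneg_le (a : nat -> R) M N :
  (forall n, 0 <= a n) -> (M <= N)%nat -> sum_n a M <= sum_n a N.
Proof.
  intros Ha H; induction H as [|N H IH]; [apply Rle_refl|].
  rewrite sum_Sn. unfold plus; simpl. specialize (Ha (S N)); lra.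
Qed.

Lemma term_le_sum_n (u : nat -> R) n N :
  (forall k, 0 <= u k) -> (n <= N)%nat -> u n <= sum_n u N.
Proof.
  intros Hu H. apply Rle_trans with (sum_n u n); [|now apply sum_n_nonneg_le].
  destruct n as [|n]; [rewrite sum_O; lra|]. rewrite Rsum_Sn.
  assert (0 <= sum_n u n); [|lra].
  eapply Rle_trans; [apply (Hu O)|]. rewrite <- (sum_O u).
  apply sum_n_nonneg_le; [exact Hu|lia].
Qed.

Lemma sum_n_le_is_series (a : nat -> R) l N :
  (forall n, 0 <= a n) -> is_series a l -> sum_n a N <= l.
Proof.
  intros Ha Hl.
  apply (is_lim_seq_incr_compare (sum_n a) l Hl).
  intros n; apply sum_n_nonneg_le; [exact Ha|lia].
Qed.

Lemma is_series_tail {K : AbsRing} {V : NormedModule K} (a : nat -> V) (l : V) N :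
  is_series a l -> is_series (fun k => a (S N + k)%nat) (minus l (sum_n a N)).
Proof.
  intros Ha. apply (is_series_incr_n a (S N)); [lia|].
  refine (eq_ind l (fun x => is_series a x) Ha _ _).
  unfold minus. rewrite <- plus_assoc. change (Init.Nat.pred (S N)) with N.
  symmetry; etransitivity; [|apply plus_zero_r]. f_equal. exact (plus_opp_l (sum_n a N)).
Qed.

Lemma Cmod_tail_le (a : nat -> C) (l : C) (b : nat -> R) (L : R) N :
  is_series a l -> is_series b L -> (forall n, Cmod (a n) <= b n) ->
  Cmod (l - sum_n a N)%C <= L - sum_n b N.
Proof.
  intros Ha Hb Hab.
  apply (Cmod_is_series_le (fun k => a (S N + k)%nat) _ (fun k => b (S N + k)%nat)).
  - exact (is_series_tail a l N Ha).
  - exact (is_series_tail b L N Hb).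
  - intros n; apply Hab.
Qed.

(** * Equidistant points of a circle and Parseval's identity *)
Definition cis (t : R) : C := (cos t, sin t).

Lemma cis_add s t : cis (s + t) = (cis s * cis t)%C.
Proof.
  unfold cis, Cmult; simpl. rewrite cos_plus, sin_plus. f_equal; ring.
Qed.

Lemma cis_pow t n : (cis t ^ n)%C = cis (INR n * t).
Proof.
  induction n as [|n IH].
  - simpl (_ ^ _)%C. rewrite Rmult_0_l. unfold cis. now rewrite cos_0, sin_0.
  - rewrite S_INR, Rmult_plus_distr_r, Rmult_1_l, Rplus_comm, cis_add, <- IH.
    reflexivity.
Qed.

Lemma Cmod_cis t : Cmod (cis t) = 1.
Proof.
  unfold Cmod, cis; simpl fst; simpl snd.
  replace (cos t ^ 2 + sin t ^ 2) with 1; [apply sqrt_1|].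
  generalize (sin2_cos2 t); unfold Rsqr; lra.
Qed.

Lemma cis_2PI_mult n : cis (INR n * (2 * PI)) = 1%C.
Proof.
  rewrite <- cis_pow. unfold cis. rewrite cos_2PI, sin_2PI.
  induction n as [|n IH]; [reflexivity|].
  simpl (_ ^ _)%C. rewrite IH. unfold RtoC, Cmult; simpl; f_equal; ring.
Qed.

Lemma cis_neq_1 t : 0 < t < 2 * PI -> cis t <> 1%C.
Proof.
  intros Ht H. apply (f_equal fst) in H. simpl in H.
  replace t with (2 * (t / 2)) in H by field.
  rewrite cos_2a_sin in H.
  assert (0 < sin (t / 2)) by (apply sin_gt_0; lra).
  nra.
Qed.

Lemma geometric_sum (q : C) N :
  ((1 - q) * sum_n (fun j => (q ^ j)%C) N = 1 - q ^ (S N))%C.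
Proof.
  induction N as [|N IH].
  - rewrite sum_O. simpl. ring.
  - rewrite Csum_Sn, Cmult_plus_distr_l, IH.
    simpl. ring.
Qed.

(** The (N+1)-st roots of unity, scaled to the circle of radius r. *)
Definition circle_point (r : R) (N j : nat) : C :=
  (r * cis (INR j * (2 * PI / INR (S N))))%C.

Lemma Cmod_circle_point r N j : 0 <= r -> Cmod (circle_point r N j) = r.
Proof.
  intros Hr. unfold circle_point.
  rewrite Cmod_mult, Cmod_cis, Cmod_R, Rabs_pos_eq by assumption. ring.
Qed.

(** A nontrivial character of the cyclic group of order N+1 sums to zero; here this is the
    geometric sum of a root of unity q different from 1. *)
Lemma sum_circle_point_pow r N d : (0 < d <= N)%nat ->
  sum_n (fun j => (circle_point r N j ^ d)%C) N = RtoC 0 :> C.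
Proof.
  intros Hd.
  assert (HN : 0 < INR (S N)) by (apply lt_0_INR; lia).
  set (q := cis (INR d * (2 * PI / INR (S N)))).
  assert (Hj : forall j, (circle_point r N j ^ d = r ^ d * q ^ j)%C).
  { intros j. unfold circle_point. rewrite Cpow_mult_l. f_equal.
    unfold q. rewrite !cis_pow. f_equal. ring. }
  rewrite (Csum_ext _ _ N (fun j _ => Hj j)).
  rewrite Csum_mult_l.
  assert (Hq : (1 - q <> 0)%C).
  { intros E. apply (cis_neq_1 (INR d * (2 * PI / INR (S N)))).
    - generalize PI_RGT_0; intros HPI.
      assert (0 < INR d) by (apply lt_0_INR; lia).
      assert (INR d < INR (S N)) by (apply lt_INR; lia).
      split; [apply Rmult_lt_0_compat; [lra|]; apply Rdiv_lt_0_compat; lra|].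
      replace (2 * PI) with (INR (S N) * (2 * PI / INR (S N))) at 2 by (field; lra).
      apply Rmult_lt_compat_r; [apply Rdiv_lt_0_compat; lra|assumption].
    - fold q. replace q with (1 - (1 - q))%C by ring. rewrite E. ring. }
  assert (Hs : sum_n (fun j => (q ^ j)%C) N = RtoC 0 :> C).
  { assert (E : ((1 - q) * sum_n (fun j => (q ^ j)%C) N = 0)%C).
    { rewrite geometric_sum. unfold q. rewrite cis_pow.
      replace (INR (S N) * (INR d * (2 * PI / INR (S N)))) with (INR d * (2 * PI))
        by (field; lra).
      rewrite cis_2PI_mult. ring. }
    replace (sum_n (fun j => (q ^ j)%C) N)
      with (/ (1 - q) * ((1 - q) * sum_n (fun j => (q ^ j)%C) N))%C by (field; exact Hq).
    rewrite E. ring. }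
  transitivity (r ^ d * 0)%C; [exact (f_equal (Cmult (r ^ d)) Hs)|ring].
Qed.

Definition polynomial (a : nat -> C) (M : nat) (z : C) : C :=
  sum_n (fun k => (a k * z ^ k)%C) M.

Lemma polynomial_S a M z :
  polynomial a (S M) z = (a O + z * polynomial (fun k => a (S k)) M z)%C.
Proof.
  unfold polynomial. induction M as [|M IH].
  - rewrite Csum_Sn, !sum_O. simpl. ring.
  - rewrite Csum_Sn, IH, (Csum_Sn _ M). simpl. ring.
Qed.

Lemma Cmod_plus_sq (u v : C) :
  Cmod (u + v)%C ^ 2 = Cmod u ^ 2 + 2 * Re (Cconj u * v)%C + Cmod v ^ 2.
Proof.
  rewrite !Cmod2_alt. destruct u, v; simpl. ring.
Qed.

Lemma sum_circle_shift r N a M : (M < N)%nat ->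
  sum_n (fun j => (circle_point r N j * polynomial a M (circle_point r N j))%C) N = RtoC 0 :> C.
Proof.
  intros HM.
  transitivity (sum_n (fun j => sum_n (fun k => (a k * circle_point r N j ^ S k)%C) M) N : C).
  { apply Csum_ext; intros j _. unfold polynomial.
    rewrite <- Csum_mult_l. apply Csum_ext; intros k _. simpl. ring. }
  rewrite sum_n_switch. rewrite (Csum_ext _ (fun _ => RtoC 0)); [apply Csum_0|].
  intros k Hk. rewrite Csum_mult_l, sum_circle_point_pow by lia. ring.
Qed.

(** By induction on the degree: in |a_0 + z Q(z)|^2 the cross term averages to zero over the
    points of the circle. There have to be more points than the degree, since z^(N+1) is
    constant on them. *)
Lemma parseval_circle r N M : 0 <= r -> (M <= N)%nat -> forall a,
  sum_n (fun j => Cmod (polynomial a M (circle_point r N j)) ^ 2) N =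
  INR (S N) * sum_n (fun k => Cmod (a k) ^ 2 * r ^ (2 * k)) M.
Proof.
  intros Hr. induction M as [|M IH]; intros HM a.
  - unfold polynomial.
    rewrite (Rsum_ext _ (fun _ => Cmod (a O) ^ 2)).
    + rewrite sum_n_const, sum_O. simpl. ring.
    + intros j _. rewrite sum_O. do 2 f_equal. simpl. ring.
  - set (z := circle_point r N).
    set (a' := fun k => a (S k)).
    rewrite (Rsum_ext _ (fun j => plus (plus (Cmod (a O) ^ 2)
       (2 * Re (Cconj (a O) * (z j * polynomial a' M (z j)))%C))
       (r ^ 2 * Cmod (polynomial a' M (z j)) ^ 2))).
    2:{ intros j _. fold z. rewrite polynomial_S. fold a'.
        rewrite Cmod_plus_sq, (Cmod_mult (z j)). unfold z at 3.
        rewrite Cmod_circle_point by assumption.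
        unfold plus; simpl; ring. }
    rewrite !sum_n_plus, sum_n_const.
    rewrite !Rsum_mult_l, <- Re_sum_n, Csum_mult_l.
    unfold z. rewrite sum_circle_shift by lia. rewrite IH by lia.
    clear. unfold plus; simpl AbelianMonoid.plus.
    replace (Re (Cconj (a O) * 0)%C) with 0
      by (destruct (a O); simpl; ring).
    replace (sum_n (fun k => Cmod (a k) ^ 2 * r ^ (2 * k)) (S M)) with
      (Cmod (a O) ^ 2 + r ^ 2 * sum_n (fun k => Cmod (a' k) ^ 2 * r ^ (2 * k)) M).
    { unfold plus; simpl. real_eq. ring. }
    induction M as [|M IH].
    + rewrite Rsum_Sn, !sum_O. unfold a'. simpl. ring.
    + rewrite Rsum_Sn, (Rsum_Sn _ (S M)), <- IH. unfold a'.
      replace (2 * S (S M))%nat with (2 + 2 * S M)%nat by lia.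
      rewrite (pow_add r 2). simpl. ring.
Qed.

(** * Complex power series: convergence, Bessel's inequality, Cauchy's estimate *)
Lemma is_pseries_C (a : nat -> C) (z l : C) :
  is_pseries a z l <-> is_series (fun k => (a k * z ^ k)%C) l.
Proof.
  assert (E : forall k, scal (pow_n z k) (a k) = (a k * z ^ k)%C).
  { intros k. replace (pow_n z k) with (z ^ k)%C.
    - change scal with Cmult. apply Cmult_comm.
    - induction k as [|k IH]; [reflexivity|]. simpl. now rewrite IH. }
  unfold is_pseries; split; apply is_series_ext; intros k; now rewrite E.
Qed.

Lemma pseries_terms_bounded (a : nat -> C) (z l : C) :
  is_pseries a z l -> exists M, forall n, Cmod (a n) * Cmod z ^ n <= M.
Proof.
  intros H%is_pseries_C.
  destruct (filterlim_bounded (K := C_AbsRing) (V := C_NormedModule)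
              (sum_n (fun k => (a k * z ^ k)%C)) (ex_intro _ l H)) as [M HM].
  change (forall n, Cmod (sum_n (fun k => (a k * z ^ k)%C) n) <= M) in HM.
  assert (HM0 : 0 <= M) by (eapply Rle_trans; [apply Cmod_ge_0|apply (HM O)]).
  exists (M + M). intros n. rewrite <- Cmod_pow, <- Cmod_mult.
  destruct n as [|n].
  - specialize (HM O). rewrite sum_O in HM. lra.
  - replace (a (S n) * z ^ S n)%C
      with (sum_n (fun k => a k * z ^ k) (S n) + - sum_n (fun k => a k * z ^ k) n)%C
      by (rewrite Csum_Sn; ring).
    eapply Rle_trans; [apply Cmod_triangle|]. rewrite Cmod_opp.
    apply Rplus_le_compat; apply HM.
Qed.

Lemma geometric_dominated (u : nat -> R) (M q : R) :
  0 <= q < 1 -> (forall n, 0 <= u n <= M * q ^ n) -> ex_series u.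
Proof.
  intros Hq Hu.
  apply (@ex_series_le R_AbsRing R_CompleteNormedModule u (fun n => M * q ^ n)).
  - intros n. change norm with Rabs. rewrite Rabs_pos_eq; apply Hu.
  - apply (@ex_series_scal R_AbsRing R_NormedModule M), ex_series_geom.
    rewrite Rabs_pos_eq; lra.
Qed.

Lemma pseries_abs_conv (a : nat -> C) (R0 M r : R) :
  0 <= r < R0 -> (forall n, Cmod (a n) * R0 ^ n <= M) ->
  ex_series (fun n => Cmod (a n) * r ^ n).
Proof.
  intros Hr HM. apply geometric_dominated with M (r / R0).
  - split; [apply Rdiv_le_0_compat; lra|]. apply Rlt_div_l; lra.
  - intros n. split; [apply Rmult_le_pos; [apply Cmod_ge_0|apply pow_le; lra]|].
    replace (Cmod (a n) * r ^ n) with (Cmod (a n) * R0 ^ n * (r / R0) ^ n).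
    + apply Rmult_le_compat_r; [|apply HM].
      apply pow_le, Rdiv_le_0_compat; lra.
    + rewrite Rmult_assoc, <- Rpow_mult_distr. do 2 f_equal. field; lra.
Qed.

Definition pseries_sum (a : nat -> C) (z : C) : C := CSeries (fun k => (a k * z ^ k)%C).

Lemma pseries_sum_unique a z l : is_pseries a z l -> pseries_sum a z = l.
Proof. intros H%is_pseries_C. now apply CSeries_unique. Qed.

Lemma pseries_sum_correct a z :
  ex_series (fun n => Cmod (a n) * Cmod z ^ n) -> is_pseries a z (pseries_sum a z).
Proof.
  intros H. apply is_pseries_C, CSeries_correct.
  eapply ex_series_ext; [|exact H]. intros n. simpl. now rewrite Cmod_mult, Cmod_pow.
Qed.

Lemma pseries_tail_le (a : nat -> C) (z l : C) (r L : R) N :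
  Cmod z <= r -> is_pseries a z l -> is_series (fun n => Cmod (a n) * r ^ n) L ->
  Cmod (l - polynomial a N z)%C <= L - sum_n (fun n => Cmod (a n) * r ^ n) N.
Proof.
  intros Hz Hl%is_pseries_C HL.
  apply Cmod_tail_le; [exact Hl|exact HL|]. intros n.
  rewrite Cmod_mult, Cmod_pow. apply Rmult_le_compat_l; [apply Cmod_ge_0|].
  apply pow_incr. split; [apply Cmod_ge_0|exact Hz].
Qed.

Lemma sum_n_Rle (u v : nat -> R) N :
  (forall n, (n <= N)%nat -> u n <= v n) -> sum_n u N <= sum_n v N.
Proof.
  intros H; induction N as [|N IH]; [rewrite !sum_O; apply H; lia|].
  rewrite !Rsum_Sn. apply Rplus_le_compat; [apply IH; intros; apply H; lia|apply H; lia].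
Qed.

(** The finite identity applies to the partial sums, which are within any given distance of
    the sum of the series on the whole circle once their degree is large. *)
Lemma bessel_circle (a : nat -> C) (r B : R) :
  0 <= r -> ex_series (fun n => Cmod (a n) * r ^ n) ->
  (forall z, Cmod z = r -> Cmod (pseries_sum a z) <= B) ->
  forall M, sum_n (fun k => Cmod (a k) ^ 2 * r ^ (2 * k)) M <= B ^ 2.
Proof.
  intros Hr [L HL] HB M.
  assert (HB0 : 0 <= B).
  { eapply Rle_trans; [apply Cmod_ge_0|apply (HB (RtoC r))].
    rewrite Cmod_R; now apply Rabs_pos_eq. }
  assert (H : forall e, 0 < e ->
     sum_n (fun k => Cmod (a k) ^ 2 * r ^ (2 * k)) M <= (B + e) ^ 2).
  { intros e He.
    destruct (HL _ (locally_ball L (mkposreal e He))) as [N0 HN0].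
    set (N := Nat.max M N0).
    specialize (HN0 N (Nat.le_max_r _ _)).
    change (Rabs (sum_n (fun n => Cmod (a n) * r ^ n) N - L) < e) in HN0.
    apply Rabs_lt_between in HN0.
    apply Rle_trans with (sum_n (fun k => Cmod (a k) ^ 2 * r ^ (2 * k)) N).
    { apply sum_n_nonneg_le; [|apply Nat.le_max_l]. intros n.
      apply Rmult_le_pos; apply pow_le; [apply Cmod_ge_0|exact Hr]. }
    assert (HN : 0 < INR (S N)) by (apply lt_0_INR; lia).
    apply Rmult_le_reg_l with (INR (S N)); [exact HN|].
    rewrite <- parseval_circle by (assumption || lia).
    rewrite <- sum_n_const. apply sum_n_Rle. intros j _.
    apply pow_incr. split; [apply Cmod_ge_0|].
    set (z := circle_point r N j).
    assert (Hz : Cmod z = r) by now apply Cmod_circle_point.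
    assert (Hl : is_pseries a z (pseries_sum a z)).
    { apply pseries_sum_correct. rewrite Hz. now exists L. }
    replace (polynomial a N z)
      with (pseries_sum a z + - (pseries_sum a z - polynomial a N z))%C by ring.
    eapply Rle_trans; [apply Cmod_triangle|]. rewrite Cmod_opp.
    apply Rplus_le_compat; [now apply HB|].
    eapply Rle_trans; [apply (pseries_tail_le a z _ r L N)|].
    - lra.
    - exact Hl.
    - exact HL.
    - lra. }
  destruct (Rle_or_lt (sum_n (fun k => Cmod (a k) ^ 2 * r ^ (2 * k)) M) (B ^ 2))
    as [|Hlt]; [assumption|exfalso].
  set (T := sum_n _ M) in *.
  set (e := Rmin 1 ((T - B ^ 2) / (2 * B + 2))).
  assert (0 < (T - B ^ 2) / (2 * B + 2)) by (apply Rdiv_lt_0_compat; lra).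
  assert (He : 0 < e) by (apply Rmin_pos; lra).
  assert (He1 : e <= 1) by apply Rmin_l.
  assert (He2 : e <= (T - B ^ 2) / (2 * B + 2)) by apply Rmin_r.
  apply Rle_div_r in He2; [|lra].
  specialize (H e He). nra.
Qed.

Lemma cauchy_estimate (a : nat -> C) (r B : R) :
  0 <= r -> ex_series (fun n => Cmod (a n) * r ^ n) ->
  (forall z, Cmod z = r -> Cmod (pseries_sum a z) <= B) ->
  forall n, Cmod (a n) * r ^ n <= B.
Proof.
  intros Hr Ha HB n.
  assert (HB0 : 0 <= B).
  { eapply Rle_trans; [apply Cmod_ge_0|apply (HB (RtoC r))].
    rewrite Cmod_R; now apply Rabs_pos_eq. }
  assert (Hp : 0 <= Cmod (a n) * r ^ n)
    by (apply Rmult_le_pos; [apply Cmod_ge_0|now apply pow_le]).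
  assert (H : (Cmod (a n) * r ^ n) ^ 2 <= B ^ 2); [|nra].
  eapply Rle_trans; [|exact (bessel_circle a r B Hr Ha HB n)].
  rewrite Rpow_mult_distr, <- pow_mult, Nat.mul_comm.
  apply (term_le_sum_n (fun k => Cmod (a k) ^ 2 * r ^ (2 * k))); [|lia]. intros k.
  apply Rmult_le_pos; apply pow_le; [apply Cmod_ge_0|exact Hr].
Qed.

(** Uniqueness is Cauchy's estimate with bound 0 for the difference of the two series. *)
Lemma pseries_coef_unique (a b : nat -> C) (f : C -> C) (r : R) :
  0 < r -> (forall z, Cmod z < r -> is_pseries a z (f z)) ->
  (forall z, Cmod z < r -> is_pseries b z (f z)) -> forall n, a n = b n.
Proof.
  intros Hr Ha Hb n.
  set (c := fun n => (a n - b n)%C).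
  assert (Hc : forall z, Cmod z < r -> is_pseries c z (RtoC 0)).
  { intros z Hz. apply is_pseries_C.
    replace (RtoC 0) with (f z - f z)%C by ring.
    eapply is_series_ext; [|exact (is_Cseries_minus _ _ _ _
      (proj1 (is_pseries_C a z (f z)) (Ha z Hz))
      (proj1 (is_pseries_C b z (f z)) (Hb z Hz)))].
    intros k. unfold c. simpl. ring. }
  destruct (pseries_terms_bounded c (RtoC (r / 2)) (RtoC 0)) as [M HM].
  { apply (Hc (RtoC (r / 2))). rewrite Cmod_R, Rabs_pos_eq; lra. }
  rewrite Cmod_R, Rabs_pos_eq in HM by lra.
  assert (H : Cmod (c n) * (r / 4) ^ n <= 0).
  { apply cauchy_estimate; [lra| |].
    - apply (pseries_abs_conv c (r / 2) M); [lra|exact HM].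
    - intros z Hz. rewrite (pseries_sum_unique _ _ _ (Hc z ltac:(lra))), Cmod_0. lra. }
  assert (Hp : 0 < (r / 4) ^ n) by (apply pow_lt; lra).
  assert (Hc0 : Cmod (c n) = 0) by (generalize (Cmod_ge_0 (c n)); nra).
  apply Cmod_eq_0 in Hc0. unfold c in Hc0.
  replace (a n) with (a n - b n + b n)%C by ring. rewrite Hc0. ring.
Qed.

(** * Recentering a power series *)
Notation binom := binomial.binomial.

Lemma binom_small m n : (m < n)%nat -> binom m n = 0%nat.
Proof. intros H. apply binomial.bin_small. now apply (ssrbool.introT ssrnat.ltP). Qed.

(** The value at z of the n-th Hasse derivative of X^m. The binomial coefficient vanishes
    where the subtraction in the exponent is truncated. *)
Definition hasse (m n : nat) (z : C) : C := (INR (binom m n) * z ^ (m - n))%C.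

Lemma hasse_0 m z : hasse m 0 z = (z ^ m)%C.
Proof. unfold hasse. rewrite binomial.bin0, Nat.sub_0_r. simpl. ring. Qed.

Lemma hasse_small m n z : (m < n)%nat -> hasse m n z = 0%C.
Proof. intros H. unfold hasse. rewrite binom_small by assumption. simpl. ring. Qed.

Lemma hasse_pascal m n z :
  hasse (S m) (S n) z = (z * hasse m (S n) z + hasse m n z)%C.
Proof.
  unfold hasse. rewrite binomial.binS. change ssrnat.addn with Nat.add.
  rewrite plus_INR, RtoC_plus. simpl (S m - S n)%nat.
  destruct (Nat.lt_ge_cases n m) as [H|H].
  - replace (m - n)%nat with (S (m - S n)) by lia. simpl. ring.
  - rewrite (binom_small m (S n)) by lia. simpl. ring.
Qed.

Lemma binomial_theorem (z w : C) m K : (m <= K)%nat ->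
  sum_n (fun n => (hasse m n z * w ^ n)%C) K = ((z + w) ^ m)%C :> C.
Proof.
  revert K; induction m as [|m IH]; intros K HK.
  - rewrite (Csum_ext _ (fun n => match n with O => RtoC 1 | _ => RtoC 0 end)).
    + clear HK; induction K as [|K IH]; [now rewrite sum_O|]. rewrite Csum_Sn, IH. simpl. ring.
    + intros [|n] _; [rewrite hasse_0; simpl; ring|].
      rewrite hasse_small by lia. ring.
  - destruct K as [|K]; [lia|].
    transitivity (z * sum_n (fun n => (hasse m n z * w ^ n)%C) (S K)
                  + w * sum_n (fun n => (hasse m n z * w ^ n)%C) K)%C.
    + clear. induction K as [|K IH].
      * rewrite !Csum_Sn, !sum_O, hasse_pascal, !hasse_0. simpl. ring.
      * rewrite (Csum_Sn _ (S K)), IH, hasse_pascal.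
        rewrite (Csum_Sn _ (S K)), (Csum_Sn _ K). simpl. ring.
    + rewrite !IH by lia. simpl. ring.
Qed.

Lemma Cmod_hasse m n z : Cmod (hasse m n z) = INR (binom m n) * Cmod z ^ (m - n).
Proof.
  unfold hasse. rewrite Cmod_mult, Cmod_R, Cmod_pow, Rabs_pos_eq; [reflexivity|apply pos_INR].
Qed.

Lemma RtoC_sum_n (u : nat -> R) N : RtoC (sum_n u N) = sum_n (fun k => RtoC (u k)) N.
Proof.
  induction N as [|N IH]; [now rewrite !sum_O|].
  rewrite Rsum_Sn, Csum_Sn, RtoC_plus. now rewrite IH.
Qed.

Lemma Cmod_hasse_sum z s m K : (m <= K)%nat ->
  sum_n (fun n => Cmod (hasse m n z) * s ^ n) K = (Cmod z + s) ^ m.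
Proof.
  intros H. apply RtoC_inj. rewrite RtoC_sum_n, RtoC_pow, RtoC_plus.
  rewrite <- (binomial_theorem (Cmod z) s m K H). apply Csum_ext; intros n _.
  rewrite Cmod_hasse. unfold hasse. now rewrite !RtoC_mult, !RtoC_pow.
Qed.

Lemma Cmod_hasse_sum_le z s m K : 0 <= s ->
  sum_n (fun n => Cmod (hasse m n z) * s ^ n) K <= (Cmod z + s) ^ m.
Proof.
  intros Hs. rewrite <- (Cmod_hasse_sum z s m (Nat.max m K)) by lia.
  apply sum_n_nonneg_le; [|lia]. intros n.
  apply Rmult_le_pos; [apply Cmod_ge_0|now apply pow_le].
Qed.

Lemma Cmod_hasse_le z s m n : 0 <= s -> Cmod (hasse m n z) * s ^ n <= (Cmod z + s) ^ m.
Proof.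
  intros Hs. eapply Rle_trans; [|apply (Cmod_hasse_sum_le z s m n Hs)].
  apply (term_le_sum_n (fun n => Cmod (hasse m n z) * s ^ n)); [|lia]. intros k.
  apply Rmult_le_pos; [apply Cmod_ge_0|now apply pow_le].
Qed.

Lemma is_series_sum_n {K : AbsRing} {V : NormedModule K} (T : nat -> nat -> V) l N :
  (forall n, is_series (T n) (l n)) ->
  is_series (fun m => sum_n (fun n => T n m) N) (sum_n l N).
Proof.
  intros H. induction N as [|N IH].
  - rewrite sum_O. apply (is_series_ext (T O)); [|apply H]. intros m. now rewrite sum_O.
  - rewrite sum_Sn. eapply is_series_ext; [|exact (is_series_plus _ _ _ _ IH (H (S N)))].
    intros m. symmetry. apply (sum_Sn (fun n => T n m)).
Qed.

Lemma Cmod_sum_n_sub_le (u : nat -> C) K N : (K <= N)%nat ->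
  Cmod (sum_n u N - sum_n u K)%C
  <= sum_n (fun n => Cmod (u n)) N - sum_n (fun n => Cmod (u n)) K.
Proof.
  intros H; induction H as [|N H IH].
  - replace (sum_n u K - sum_n u K)%C with (RtoC 0) by ring. rewrite Cmod_0. lra.
  - rewrite Csum_Sn, Rsum_Sn.
    replace (sum_n u N + u (S N) - sum_n u K)%C
      with ((sum_n u N - sum_n u K) + u (S N))%C by ring.
    eapply Rle_trans; [apply Cmod_triangle|lra].
Qed.

Lemma is_Cseries_eps (u : nat -> C) (l : C) :
  (forall e, 0 < e -> exists N, forall n, (N <= n)%nat -> Cmod (l - sum_n u n)%C < e) ->
  is_series u l.
Proof.
  intros H P [e He].
  destruct (H e (cond_pos e)) as [N HN].
  exists N. intros n Hn. apply He. apply C_NormedModule_mixin_compat1.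
  rewrite <- Cmod_opp. eapply Rle_lt_trans; [|apply (HN n Hn)].
  right. f_equal. change (minus (sum_n u n) l) with (sum_n u n - l)%C. ring.
Qed.

Definition taylor (a : nat -> C) (z0 : C) (n : nat) : C :=
  CSeries (fun m => (a m * hasse m n z0)%C).

Section Recentering.

Variables (a : nat -> C) (rho M : R).
Hypothesis Ha : forall n, Cmod (a n) * rho ^ n <= M.

Lemma taylor_abs_conv z0 n : Cmod z0 < rho ->
  ex_series (fun m => Cmod (a m * hasse m n z0)%C).
Proof.
  intros Hz.
  set (s := (rho - Cmod z0) / 2).
  assert (Hs : 0 < s) by (unfold s; lra).
  assert (Hz0 := Cmod_ge_0 z0).
  apply (@ex_series_le R_AbsRing R_CompleteNormedModule _
           (fun m => / s ^ n * (Cmod (a m) * (Cmod z0 + s) ^ m))).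
  - intros m. change norm with Rabs. rewrite Rabs_pos_eq by apply Cmod_ge_0.
    rewrite Cmod_mult.
    assert (Hp : 0 < s ^ n) by now apply pow_lt.
    replace (Cmod (a m) * Cmod (hasse m n z0))
      with (/ s ^ n * (Cmod (a m) * (Cmod (hasse m n z0) * s ^ n))) by (field; lra).
    apply Rmult_le_compat_l; [left; now apply Rinv_0_lt_compat|].
    apply Rmult_le_compat_l; [apply Cmod_ge_0|]. apply Cmod_hasse_le; lra.
  - apply (@ex_series_scal R_AbsRing R_NormedModule).
    apply (pseries_abs_conv a rho M); [unfold s in *; lra|exact Ha].
Qed.

Lemma is_series_taylor z0 n : Cmod z0 < rho ->
  is_series (fun m => (a m * hasse m n z0)%C) (taylor a z0 n).
Proof. intros Hz. now apply CSeries_correct, taylor_abs_conv. Qed.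

(** No rearrangement of a double series is needed: the partial sum of order K of the new
    expansion is itself a series over the old index m, whose terms agree with a_m (z0 + w)^m
    for m up to K. The error is therefore at most the tail of the majorant
    |a_m| (|z0| + |w|)^m. *)
Lemma taylor_pseries z0 w : Cmod z0 + Cmod w < rho ->
  is_pseries (taylor a z0) w (pseries_sum a (z0 + w)%C).
Proof.
  intros Hzw. assert (Hz0 := Cmod_ge_0 z0). assert (Hw := Cmod_ge_0 w).
  apply is_pseries_C.
  set (h := fun m n => (hasse m n z0 * w ^ n)%C).
  assert (Hh : forall m n, Cmod (h m n) = Cmod (hasse m n z0) * Cmod w ^ n).
  { intros m n. unfold h. now rewrite Cmod_mult, Cmod_pow. }
  assert (Hsum : forall K,
     is_series (fun m => (a m * sum_n (h m) K)%C)
       (sum_n (fun n => (taylor a z0 n * w ^ n)%C) K)).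
  { intros K. eapply is_series_ext; [|apply (is_series_sum_n (V := C_NormedModule)
      (fun n m => (w ^ n * (a m * hasse m n z0))%C))].
    - intros m. rewrite <- Csum_mult_l. apply Csum_ext; intros n _. unfold h. ring.
    - intros n. rewrite Cmult_comm. apply is_Cseries_scal, is_series_taylor. lra. }
  set (u := fun m => Cmod (a m) * (Cmod z0 + Cmod w) ^ m).
  destruct (pseries_abs_conv a rho M (Cmod z0 + Cmod w)) as [U HU]; [lra|exact Ha|].
  fold u in HU.
  assert (Hl : is_pseries a (z0 + w)%C (pseries_sum a (z0 + w)%C)).
  { apply pseries_sum_correct.
    apply (pseries_abs_conv a rho M); [|exact Ha]. split; [apply Cmod_ge_0|].
    eapply Rle_lt_trans; [apply Cmod_triangle|exact Hzw]. }
  set (l := pseries_sum a (z0 + w)%C) in *. apply is_pseries_C in Hl.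
  assert (Herr : forall K,
     Cmod (l - sum_n (fun n => (taylor a z0 n * w ^ n)%C) K)%C <= U - sum_n u K).
  { intros K.
    set (e := fun m => (a m * ((z0 + w) ^ m - sum_n (h m) K))%C).
    assert (He : is_series e (l - sum_n (fun n => (taylor a z0 n * w ^ n)%C) K)%C).
    { eapply is_series_ext; [|exact (is_Cseries_minus _ _ _ _ Hl (Hsum K))].
      intros m. unfold e. simpl. ring. }
    assert (He0 : sum_n e K = RtoC 0 :> C).
    { rewrite (Csum_ext _ (fun _ => RtoC 0)); [apply Csum_0|].
      intros m Hm. unfold e, h. rewrite binomial_theorem by assumption. ring. }
    replace (l - sum_n (fun n => (taylor a z0 n * w ^ n)%C) K)%C
      with (l - sum_n (fun n => (taylor a z0 n * w ^ n)%C) K - sum_n e K)%C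
      by (rewrite He0; ring).
    apply Cmod_tail_le; [exact He|exact HU|].
    intros m. unfold e, u. rewrite Cmod_mult.
    apply Rmult_le_compat_l; [apply Cmod_ge_0|].
    rewrite <- (binomial_theorem z0 w m (Nat.max m K)) by lia. fold (h m).
    eapply Rle_trans; [apply Cmod_sum_n_sub_le; lia|].
    rewrite !(Rsum_ext _ _ _ (fun n _ => Hh m n)).
    rewrite Cmod_hasse_sum by lia.
    assert (0 <= sum_n (fun n => Cmod (hasse m n z0) * Cmod w ^ n) K); [|lra].
    eapply Rle_trans; [|apply (term_le_sum_n _ O); [|lia]].
    - apply Rmult_le_pos; [apply Cmod_ge_0|now apply pow_le].
    - intros n; apply Rmult_le_pos; [apply Cmod_ge_0|now apply pow_le]. }
  apply is_Cseries_eps. intros e He.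
  destruct (HU _ (locally_ball U (mkposreal e He))) as [N HN].
  exists N. intros n Hn. specialize (HN n Hn).
  change (Rabs (sum_n u n - U) < e) in HN. apply Rabs_lt_between in HN.
  eapply Rle_lt_trans; [apply Herr|lra].
Qed.

Lemma taylor_coef_bound z0 s n : 0 < rho -> 0 <= s -> Cmod z0 + s <= rho / 2 ->
  Cmod (taylor a z0 n) * s ^ n <= 2 * M.
Proof.
  intros Hrho Hs Hzs. assert (Hz0 := Cmod_ge_0 z0).
  assert (Hp : 0 <= s ^ n) by now apply pow_le.
  rewrite <- (Rabs_pos_eq (s ^ n)), <- Cmod_R, <- Cmod_mult by assumption.
  apply (Cmod_is_series_le (fun m => (s ^ n * (a m * hasse m n z0))%C) _
           (fun m => M * (/ 2) ^ m)).
  - rewrite RtoC_pow, Cmult_comm. apply is_Cseries_scal, is_series_taylor; lra.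
  - replace (2 * M) with (M * / (1 - / 2)) by field.
    apply (@is_series_scal R_AbsRing R_NormedModule), is_series_geom.
    rewrite Rabs_pos_eq; lra.
  - intros m. rewrite !Cmod_mult, <- RtoC_pow, Cmod_R, Rabs_pos_eq by assumption.
    rewrite (Rmult_comm (s ^ n)), Rmult_assoc.
    assert (Hr : 0 < (/ rho) ^ m) by (apply pow_lt, Rinv_0_lt_compat, Hrho).
    apply Rle_trans with (Cmod (a m) * (rho / 2) ^ m).
    + apply Rmult_le_compat_l; [apply Cmod_ge_0|].
      eapply Rle_trans; [now apply Cmod_hasse_le|]. apply pow_incr; lra.
    + unfold Rdiv. rewrite Rpow_mult_distr, <- Rmult_assoc.
      apply Rmult_le_compat_r; [apply pow_le; lra|apply Ha].
Qed.

End Recentering.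

(** * Analytic functions on the disk are sums of power series *)
Definition expansion_within (a : nat -> C) (f : C -> C) (rho : R) : Prop :=
  forall z, Cmod z < rho -> is_pseries a z (f z).

Lemma expansion_coef_bound a f rho r :
  expansion_within a f rho -> 0 <= r < rho ->
  exists M, 1 <= M /\ forall n, Cmod (a n) * r ^ n <= M.
Proof.
  intros Hf Hr.
  destruct (pseries_terms_bounded a (RtoC r) (f (RtoC r))) as [M HM].
  - apply Hf. rewrite Cmod_R, Rabs_pos_eq; lra.
  - rewrite Cmod_R, Rabs_pos_eq in HM by lra.
    exists (Rmax 1 M). split; [apply Rmax_l|]. intros n.
    eapply Rle_trans; [apply HM|apply Rmax_r].
Qed.

Lemma expansion_recenter a f rho z0 w :
  expansion_within a f rho -> Cmod z0 + Cmod w < rho ->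
  is_pseries (taylor a z0) w (f (z0 + w)%C).
Proof.
  intros Hf Hzw. assert (Hz0 := Cmod_ge_0 z0). assert (Hw := Cmod_ge_0 w).
  destruct (expansion_coef_bound a f rho ((Cmod z0 + Cmod w + rho) / 2) Hf) as [M [_ HM]];
    [lra|].
  rewrite <- (pseries_sum_unique a (z0 + w)%C (f (z0 + w)%C)).
  - apply (taylor_pseries a ((Cmod z0 + Cmod w + rho) / 2) M HM). lra.
  - apply Hf. eapply Rle_lt_trans; [apply Cmod_triangle|exact Hzw].
Qed.

(** One parameter d controls both the radius and the coefficients: compactness only provides
    a positive lower bound for a positive function of the centre, and a bound for the
    coefficients is obtained from it as the inverse of such a lower bound. *)
Definition local_expansion (f : C -> C) (z0 : C) (d : R) : Prop :=
  exists c, expansion_within c (fun w => f (z0 + w)%C) d /\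
    forall n, Cmod (c n) * d ^ n <= 2 / d.

Lemma local_expansion_nearby f z0 a r :
  0 < r -> (forall z, Cmod (z - z0)%C < r -> is_pseries a (z - z0)%C (f z)) ->
  exists delta, 0 < delta /\ forall z d, Cmod (z - z0)%C <= 2 * delta ->
    0 < d <= delta -> local_expansion f z d.
Proof.
  intros Hr Ha.
  assert (Hg : expansion_within a (fun w => f (z0 + w)%C) r).
  { intros w Hw. replace w with (z0 + w - z0)%C at 1 by ring. apply Ha.
    replace (z0 + w - z0)%C with w by ring. exact Hw. }
  destruct (expansion_coef_bound a _ r (r / 2) Hg) as [M [HM1 HM]]; [lra|].
  (* centres within r/8 of z0 and displacements below r/16 stay inside radius r/2 *)
  exists (Rmin (r / 16) (/ M)).
  assert (HM' : 0 < / M) by (apply Rinv_0_lt_compat; lra).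
  split; [apply Rmin_pos; lra|]. intros z d Hz Hd.
  assert (H1 := Rmin_l (r / 16) (/ M)). assert (H2 := Rmin_r (r / 16) (/ M)).
  exists (taylor a (z - z0)%C). split.
  - intros w Hw. replace (z + w)%C with (z0 + (z - z0 + w))%C by ring.
    apply (expansion_recenter a (fun w => f (z0 + w)%C) r); [exact Hg|lra].
  - intros n. eapply Rle_trans; [apply (taylor_coef_bound a (r / 2) M HM); lra|].
    unfold Rdiv. apply Rmult_le_compat_l; [lra|].
    rewrite <- (Rinv_inv M). apply Rinv_le_contravar; lra.
Qed.

Lemma Cmod_le_abs (x y : R) : Cmod (x, y) <= Rabs x + Rabs y.
Proof.
  replace ((x, y) : C) with (RtoC x + Ci * RtoC y)%C
    by (unfold RtoC, Ci, Cmult, Cplus; simpl; f_equal; ring).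
  eapply Rle_trans; [apply Cmod_triangle|].
  rewrite Cmod_mult, Cmod_Ci, !Cmod_R. lra.
Qed.

Lemma local_expansion_uniform f rho :
  analytic_on_disk f -> rho < 1 ->
  exists d, 0 < d /\ forall z, Cmod z <= rho -> local_expansion f z d.
Proof.
  intros Hf Hrho.
  assert (H : forall u v : R, exists delta : posreal, forall x y d,
     Rabs (x - u) < delta -> Rabs (y - v) < delta -> Cmod (x, y) <= rho ->
     0 < d <= delta -> local_expansion f (x, y) d).
  { intros u v. destruct (Rle_or_lt (Cmod (u, v)) rho) as [Huv|Huv].
    - destruct (Hf (u, v)) as (a & r & Hr & Ha); [unfold disk; lra|].
      destruct (local_expansion_nearby f (u, v) a r Hr Ha) as (delta & Hdelta & H).
      exists (mkposreal delta Hdelta). simpl. intros x y d Hx Hy _ Hd.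
      apply H; [|exact Hd].
      change ((x, y) - (u, v))%C with ((x - u, y - v) : C).
      eapply Rle_trans; [apply Cmod_le_abs|lra].
    - (* outside the closed disk, choose a neighbourhood that does not meet it *)
      assert (Hp : 0 < (Cmod (u, v) - rho) / 2) by lra.
      exists (mkposreal _ Hp). simpl. intros x y d Hx Hy Hxy _. exfalso.
      assert (Ht := Cmod_triangle (x, y) (u - x, v - y)).
      replace ((x, y) + ((u - x)%R, (v - y)%R))%C with ((u, v) : C) in Ht
        by (unfold Cplus; simpl; f_equal; ring).
      assert (Ha := Cmod_le_abs (u - x) (v - y)).
      rewrite (Rabs_minus_sym u), (Rabs_minus_sym v) in Ha. lra. }
  set (delta := fun u v => proj1_sig (constructive_indefinite_description _ (H u v))).
  destruct (compactness_value_2d (-1) 1 (-1) 1 delta) as [d Hd].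
  exists d. split; [apply cond_pos|]. intros [x y] Hz.
  assert (Hx := re_le_Cmod (x, y)). assert (Hy := im_le_Cmod (x, y)). simpl in Hx, Hy.
  destruct (NNPP _ (Hd x y ltac:(apply Rabs_le_between; lra)
     ltac:(apply Rabs_le_between; lra))) as (u & v & _ & _ & Hu & Hv & Hduv).
  unfold delta in *.
  destruct (constructive_indefinite_description _ (H u v)) as [e He]. simpl in *.
  apply He; try assumption. split; [apply cond_pos|exact Hduv].
Qed.

(** Let r be slightly smaller than rho. On the circle of radius r the n-th Taylor coefficient
    is at most (2/d) / d^n, and z^n times it is a power series in z with coefficients
    binom(m,n) a_m. Cauchy's estimate bounds each binom(m,n) |a_m| r^(m-n) by (2/d) / d^n, and
    the binomial theorem turns these bounds into a bound of |a_m| (r + d/2)^m. Hence the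
    series converges beyond rho, and there it agrees with f because its recentering at
    points of the circle does. *)
Lemma expansion_extends a f rho d :
  0 < rho -> 0 < d -> expansion_within a f rho ->
  (forall z, Cmod z < rho -> local_expansion f z d) ->
  exists rho', rho < rho' /\ expansion_within a f rho'.
Proof.
  intros Hrho Hd Ha Hloc.
  set (r := Rmax (rho / 2) (rho - d / 8)).
  assert (Hr : 0 < r < rho /\ rho <= r + d / 8).
  { unfold r. split; [split|].
    - eapply Rlt_le_trans; [|apply Rmax_l]; lra.
    - apply Rmax_lub_lt; lra.
    - generalize (Rmax_r (rho / 2) (rho - d / 8)); lra. }
  destruct Hr as [Hr Hrd]. clearbody r.
  assert (Htaylor : forall z, Cmod z = r ->
     expansion_within (taylor a z) (fun w => f (z + w)%C) d /\
     forall n, Cmod (taylor a z n) * d ^ n <= 2 / d).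
  { intros z Hz. destruct (Hloc z) as (c & Hc & Hcd); [lra|].
    assert (E : forall n, taylor a z n = c n).
    { apply (pseries_coef_unique _ _ (fun w => f (z + w)%C) (Rmin d (rho - r))).
      - apply Rmin_pos; lra.
      - intros w Hw. apply (expansion_recenter a f rho); [exact Ha|].
        assert (Hm := Rmin_r d (rho - r)). lra.
      - intros w Hw. apply Hc. eapply Rlt_le_trans; [exact Hw|apply Rmin_l]. }
    split.
    - intros w Hw. eapply is_series_ext; [|exact (Hc w Hw)]. intros n. simpl. now rewrite E.
    - intros n. rewrite E. apply Hcd. }
  destruct (expansion_coef_bound a f rho ((r + rho) / 2) Ha) as [M [_ HM]]; [lra|].
  assert (Hpart : forall m n,
     Cmod (a m) * Cmod (hasse m n r) * d ^ n <= 2 / d).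
  { intros m n.
    assert (Hdn : 0 < d ^ n) by now apply pow_lt.
    assert (Hrn : 0 < r ^ n) by (apply pow_lt; lra).
    set (b := fun m => (a m * INR (binom m n))%C).
    assert (Hb : forall z m, (b m * z ^ m = z ^ n * (a m * hasse m n z))%C).
    { intros z k. unfold b, hasse. destruct (Nat.le_gt_cases n k) as [Hk|Hk].
      - replace (z ^ k)%C with (z ^ n * z ^ (k - n))%C; [ring|].
        rewrite <- Cpow_add_r. f_equal. lia.
      - rewrite binom_small by assumption. simpl. ring. }
    assert (Hsum : forall z, Cmod z = r -> is_pseries b z (z ^ n * taylor a z n)%C).
    { intros z Hz. apply is_pseries_C.
      eapply is_series_ext; [intros k; symmetry; apply Hb|].
      apply is_Cseries_scal, (is_series_taylor a ((r + rho) / 2) M HM). lra. }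
    assert (Hbr : forall k, Cmod (b k) * r ^ k = r ^ n * Cmod (a k * hasse k n r)%C).
    { intros k. assert (E := f_equal Cmod (Hb r k)).
      rewrite !Cmod_mult, !Cmod_pow, !Cmod_R, !(Rabs_pos_eq r) in E by lra.
      now rewrite Cmod_mult. }
    assert (Hest : Cmod (b m) * r ^ m <= r ^ n * (2 / d / d ^ n)).
    { apply cauchy_estimate; [lra| |].
      - eapply ex_series_ext; [intros k; symmetry; apply Hbr|].
        apply (@ex_series_scal R_AbsRing R_NormedModule (r ^ n)).
        apply (taylor_abs_conv a ((r + rho) / 2) M HM). rewrite Cmod_R, Rabs_pos_eq; lra.
      - intros z Hz. rewrite (pseries_sum_unique _ _ _ (Hsum z Hz)).
        rewrite Cmod_mult, Cmod_pow, Hz. apply Rmult_le_compat_l; [lra|].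
        apply Rle_div_r; [lra|]. now apply Htaylor. }
    rewrite Hbr in Hest. apply Rmult_le_reg_l in Hest; [|exact Hrn].
    apply Rle_div_r in Hest; [|exact Hdn]. now rewrite Cmod_mult in Hest. }
  assert (Hbound : forall m, Cmod (a m) * (r + d / 2) ^ m <= 4 / d).
  { intros m. replace r with (Cmod (RtoC r)) at 1 by (rewrite Cmod_R, Rabs_pos_eq; lra).
    rewrite <- (Cmod_hasse_sum r (d / 2) m m) by lia. rewrite <- Rsum_mult_l.
    apply Rle_trans with (sum_n (fun n => 2 / d * (/ 2) ^ n) m).
    - apply sum_n_Rle. intros n _.
      replace (Cmod (a m) * (Cmod (hasse m n r) * (d / 2) ^ n))
        with (Cmod (a m) * Cmod (hasse m n r) * d ^ n * (/ 2) ^ n)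
        by (unfold Rdiv; rewrite Rpow_mult_distr; ring).
      apply Rmult_le_compat_r; [apply pow_le; lra|apply Hpart].
    - replace (4 / d) with (2 / d * / (1 - / 2)) by (field; lra).
      assert (0 < 2 / d) by (apply Rdiv_lt_0_compat; lra).
      apply sum_n_le_is_series.
      + intros n. apply Rmult_le_pos; [lra|]. apply pow_le; lra.
      + apply (@is_series_scal R_AbsRing R_NormedModule), is_series_geom.
        rewrite Rabs_pos_eq; lra. }
  exists (r + d / 4). split; [lra|]. intros z Hz.
  destruct (Rlt_or_le (Cmod z) rho) as [Hlt|Hge]; [now apply Ha|].
  assert (Hz0 : z <> 0%C) by (apply Cmod_gt_0; lra).
  (* the radial projection of z to the circle of radius r, and the remaining displacement *)
  set (z' := (RtoC (r / Cmod z) * z)%C).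
  set (w := (RtoC (1 - r / Cmod z) * z)%C).
  assert (Hq : 0 <= r / Cmod z <= 1).
  { split; [apply Rdiv_le_0_compat; lra|]. apply Rle_div_l; lra. }
  assert (Hz' : Cmod z' = r).
  { unfold z'. rewrite Cmod_mult, Cmod_R, Rabs_pos_eq by lra. field; lra. }
  assert (Hw : Cmod w = Cmod z - r).
  { unfold w. rewrite Cmod_mult, Cmod_R, Rabs_pos_eq by lra. field; lra. }
  assert (Ezw : z = (z' + w)%C) by (unfold z', w; rewrite RtoC_minus; ring).
  assert (H1 := proj1 (Htaylor z' Hz') w ltac:(lra)). simpl in H1.
  assert (H2 := taylor_pseries a (r + d / 2) (4 / d) Hbound z' w ltac:(lra)).
  rewrite <- Ezw in H1, H2.
  rewrite <- (pseries_sum_unique _ _ _ H1), (pseries_sum_unique _ _ _ H2).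
  apply pseries_sum_correct.
  apply (pseries_abs_conv a (r + d / 2) (4 / d)); [lra|exact Hbound].
Qed.

(** The supremum of the radii up to 1 within which f agrees with its expansion at 0 is attained,
    and it cannot be smaller than 1, as the expansion would extend further. *)
Lemma analytic_power_series f :
  analytic_on_disk f -> exists a, power_series_on_disk a f.
Proof.
  intros Hf.
  destruct (Hf (RtoC 0)) as (a & r & Hr & Ha); [unfold disk; rewrite Cmod_0; lra|].
  exists a.
  set (E := fun rho => rho <= 1 /\ expansion_within a f rho).
  assert (Hr1 : E (Rmin r 1)).
  { split; [apply Rmin_r|]. intros z Hz. replace z with (z - 0)%C at 1 by ring. apply Ha.
    replace (z - 0)%C with z by ring. eapply Rlt_le_trans; [exact Hz|apply Rmin_l]. }
  destruct (completeness E) as [rho [Hub Hlub]].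
  { exists 1. intros x [Hx _]. exact Hx. }
  { now exists (Rmin r 1). }
  assert (Hpos : 0 < rho).
  { eapply Rlt_le_trans; [|apply (Hub _ Hr1)]. apply Rmin_pos; lra. }
  assert (HE : expansion_within a f rho).
  { intros z Hz. apply NNPP; intros Hn.
    apply (Rlt_not_le _ _ Hz), Hlub. intros x [_ Hx].
    apply Rnot_lt_le; intros Hlt. apply Hn, Hx, Hlt. }
  destruct (Rlt_or_le rho 1) as [Hlt|Hge].
  - destruct (local_expansion_uniform f rho Hf Hlt) as (d & Hd & Hloc).
    destruct (expansion_extends a f rho d Hpos Hd HE) as (rho' & Hrho' & HE').
    { intros z Hz. apply Hloc; lra. }
    exfalso. assert (Hx : E (Rmin rho' 1)).
    { split; [apply Rmin_r|]. intros z Hz. apply HE'.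
      eapply Rlt_le_trans; [exact Hz|apply Rmin_l]. }
    apply Hub in Hx. apply (Rlt_not_le _ _ (Rmin_glb_lt _ _ _ Hrho' Hlt) Hx).
  - intros z Hz. apply HE. unfold disk in Hz. lra.
Qed.

Lemma power_series_analytic a f : power_series_on_disk a f -> analytic_on_disk f.
Proof.
  intros Hf z0 Hz0. exists (taylor a z0), (1 - Cmod z0).
  unfold disk in Hz0. split; [lra|]. intros z Hz.
  replace z with (z0 + (z - z0))%C at 2 by ring.
  apply (expansion_recenter a f 1); [exact Hf|lra].
Qed.

(** * Termwise differentiation *)
(** [C_derive] is a limit along the horizontal line through z only, so that an ordinary
    complex derivative determines it. *)
Lemma C_derive_eps (f : C -> C) (z l : C) :
  (forall e, 0 < e -> exists delta, 0 < delta /\ forall w : C, w <> 0%C -> Cmod w < delta ->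
     Cmod ((f (z + w)%C - f z) / w - l)%C < e) ->
  C_derive f z = l.
Proof.
  intros H. destruct z as [x y], l as [lx ly].
  assert (Hq : forall e, 0 < e -> exists delta : posreal, forall t : R,
     Rabs (t - x) < delta -> t <> x ->
     Cmod ((f (t, y) - f (x, y)) / ((t, y) - (x, y)) - (lx, ly))%C < e).
  { intros e He. destruct (H e He) as (delta & Hdelta & Hw).
    exists (mkposreal delta Hdelta). simpl. intros t Ht Htx.
    assert (E : ((t, y) - (x, y))%C = RtoC (t - x))
      by (unfold Cminus, Cplus, Copp, RtoC; simpl; f_equal; ring).
    specialize (Hw (RtoC (t - x))). rewrite <- E in Hw.
    replace ((x, y) + ((t, y) - (x, y)))%C with ((t, y) : C) in Hw
      by (unfold Cminus, Cplus, Copp; simpl; f_equal; ring).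
    apply Hw; rewrite E.
    - intros E0. apply RtoC_inj in E0. lra.
    - now rewrite Cmod_R. }
  set (q := fun t : R => ((f (t, y) - f (x, y)) / ((t, y) - (x, y)))%C).
  change (C_derive f (x, y))
    with ((real (Lim (fun t => Re (q t)) x), real (Lim (fun t => Im (q t)) x)) : C).
  assert (Hlim : is_lim (fun t => Re (q t)) x lx /\ is_lim (fun t => Im (q t)) x ly).
  { split; apply is_lim_spec; intros e;
      destruct (Hq e (cond_pos e)) as [delta Hd]; exists delta; intros t Ht Htx;
      (eapply Rle_lt_trans; [|exact (Hd t Ht Htx)]); fold (q t).
    - apply (re_le_Cmod (q t - (lx, ly))%C).
    - apply (im_le_Cmod (q t - (lx, ly))%C). }
  destruct Hlim as [H1 H2]. now rewrite (is_lim_unique _ _ _ H1), (is_lim_unique _ _ _ H2).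
Qed.

Lemma C_derive_expansion (c : nat -> C) (f : C -> C) (z : C) (d : R) :
  0 < d -> expansion_within c (fun w => f (z + w)%C) d -> C_derive f z = c 1%nat.
Proof.
  intros Hd Hc.
  destruct (expansion_coef_bound c _ d (d / 2) Hc) as [M [_ HM]]; [lra|].
  assert (Hconv : ex_series (fun k => Cmod (c (2 + k)%nat) * (d / 4) ^ k)).
  { apply (ex_series_ext
      (fun k => / (d / 4) ^ 2 * (Cmod (c (2 + k)%nat) * (d / 4) ^ (2 + k)))).
    - intros k. rewrite (pow_add _ 2 k).
      assert (0 < (d / 4) ^ 2) by (apply pow_lt; lra).
      real_eq. field; lra.
    - apply (@ex_series_scal R_AbsRing R_NormedModule (/ (d / 4) ^ 2)).
      apply (proj1 (ex_series_incr_n (fun k => Cmod (c k) * (d / 4) ^ k) 2)).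
      apply (pseries_abs_conv c (d / 2) M); [lra|exact HM]. }
  destruct Hconv as [L HL].
  assert (HL0 : 0 <= L).
  { eapply Rle_trans; [|apply (sum_n_le_is_series (fun k => Cmod (c (2 + k)%nat) * (d / 4) ^ k) L 0%nat); [|exact HL]].
    - rewrite sum_O. apply Rmult_le_pos; [apply Cmod_ge_0|apply pow_le; lra].
    - intros k. apply Rmult_le_pos; [apply Cmod_ge_0|apply pow_le; lra]. }
  assert (Hrem : forall w, Cmod w <= d / 4 ->
     Cmod (f (z + w)%C - (c 0%nat + c 1%nat * w))%C <= Cmod w ^ 2 * L).
  { intros w Hw.
    assert (Hs := proj1 (is_pseries_C _ _ _) (Hc w ltac:(lra))).
    apply (is_series_tail _ _ 1) in Hs.
    rewrite Csum_Sn, sum_O in Hs.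
    replace (f (z + w) - (c 0%nat + c 1%nat * w))%C
      with (f (z + w) - (c 0%nat * w ^ 0 + c 1%nat * w ^ 1))%C by (simpl; ring).
    apply (Cmod_is_series_le _ _ (fun k => Cmod w ^ 2 * (Cmod (c (2 + k)%nat) * (d / 4) ^ k))
             _ Hs).
    - apply (@is_series_scal R_AbsRing R_NormedModule), HL.
    - intros k. cbv beta. rewrite Cmod_mult, Cmod_pow, (pow_add _ 2 k).
      replace (Cmod (c (2 + k)%nat) * (Cmod w ^ 2 * Cmod w ^ k))
        with (Cmod w ^ 2 * (Cmod (c (2 + k)%nat) * Cmod w ^ k)) by ring.
      apply Rmult_le_compat_l; [apply pow_le, Cmod_ge_0|].
      apply Rmult_le_compat_l; [apply Cmod_ge_0|].
      apply pow_incr. split; [apply Cmod_ge_0|exact Hw]. }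
  assert (Hf0 : f z = c 0%nat).
  { assert (H0 := Hrem (RtoC 0)). rewrite Cmod_0 in H0.
    specialize (H0 ltac:(lra)).
    replace (z + 0)%C with z in H0 by ring.
    replace (f z - (c 0%nat + c 1%nat * 0))%C with (f z - c 0%nat)%C in H0 by ring.
    assert (E : Cmod (f z - c 0%nat)%C = 0) by (generalize (Cmod_ge_0 (f z - c 0%nat)%C); lra).
    apply Cmod_eq_0 in E. replace (f z) with (f z - c 0%nat + c 0%nat)%C by ring.
    rewrite E. ring. }
  apply C_derive_eps. intros e He.
  exists (Rmin (d / 4) (e / (L + 1))).
  assert (0 < e / (L + 1)) by (apply Rdiv_lt_0_compat; lra).
  split; [apply Rmin_pos; lra|]. intros w Hw0 Hw.
  assert (Hw1 : Cmod w < d / 4) by (eapply Rlt_le_trans; [exact Hw|apply Rmin_l]).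
  assert (Hw2 : Cmod w < e / (L + 1)) by (eapply Rlt_le_trans; [exact Hw|apply Rmin_r]).
  apply Rlt_div_r in Hw2; [|lra].
  assert (Hwp := proj1 (Cmod_gt_0 w) Hw0).
  rewrite Hf0.
  replace ((f (z + w) - c 0%nat) / w - c 1%nat)%C
    with ((f (z + w) - (c 0%nat + c 1%nat * w)) / w)%C by (field; exact Hw0).
  rewrite Cmod_div by exact Hw0. apply Rlt_div_l; [exact Hwp|].
  eapply Rle_lt_trans; [apply Hrem; lra|]. nra.
Qed.

Definition derived_coef (a : nat -> C) (k : nat) : C := (INR (S k) * a (S k))%C.

Lemma C_derive_power_series a f z :
  power_series_on_disk a f -> disk z -> is_pseries (derived_coef a) z (C_derive f z).
Proof.
  intros Hf Hz. unfold disk in Hz. assert (Hz0 := Cmod_ge_0 z).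
  assert (Ht : expansion_within (taylor a z) (fun w => f (z + w)%C) (1 - Cmod z)).
  { intros w Hw. apply (expansion_recenter a f 1); [exact Hf|lra]. }
  rewrite (C_derive_expansion (taylor a z) f z (1 - Cmod z)); [|lra|exact Ht].
  destruct (expansion_coef_bound a f 1 ((Cmod z + 1) / 2) Hf) as [M [_ HM]]; [lra|].
  assert (Hs := is_series_taylor a ((Cmod z + 1) / 2) M HM z 1 ltac:(lra)).
  apply is_pseries_C. apply (is_series_tail _ _ 0) in Hs. rewrite sum_O in Hs.
  rewrite hasse_small in Hs by lia.
  assert (E : (taylor a z 1 - a 0%nat * 0)%C = taylor a z 1) by ring.
  change (@minus _ (taylor a z 1)) with (Cminus (taylor a z 1)) in Hs. rewrite E in Hs.
  eapply is_series_ext; [|exact Hs]. intros k. cbv beta. change (1 + k)%nat with (S k).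
  unfold derived_coef, hasse. rewrite binomial.bin1.
  replace (S k - 1)%nat with k by lia. complex_eq. ring.
Qed.

(** * Coefficients of a Bloch function *)
Lemma ex_series_of_bounded (u : nat -> R) B :
  (forall n, 0 <= u n) -> (forall n, sum_n u n <= B) -> ex_series u.
Proof.
  intros Hu HB.
  destruct (ex_finite_lim_seq_incr (sum_n u) B) as [l Hl]; [|exact HB|].
  - intros n. apply sum_n_nonneg_le; [exact Hu|lia].
  - now exists l.
Qed.

Lemma block_sum_le (x u : nat -> R) (A d : nat) (N mu : R) :
  0 < N -> 0 < mu ->
  (forall k, (A <= k)%nat -> u k <= x k / N ^ 2) ->
  sum_n u (A + d) - sum_n u A <=
  / 2 * ((sum_n (fun k => x k ^ 2) (A + d) - sum_n (fun k => x k ^ 2) A) / (N ^ 2 * mu)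
         + INR d * (mu / N ^ 2)).
Proof.
  intros HN Hmu Hu.
  assert (HN2 : 0 < N ^ 2) by now apply pow_lt.
  induction d as [|d IH].
  - rewrite Nat.add_0_r. simpl INR. apply Req_le. field. lra.
  - replace (A + S d)%nat with (S (A + d)) by lia.
    rewrite !Rsum_Sn, S_INR.
    assert (Hk := Hu (S (A + d)) ltac:(lia)).
    set (y := x (S (A + d))) in *.
    assert (Hy : y / N ^ 2 <= / 2 * (y ^ 2 / (N ^ 2 * mu) + mu / N ^ 2)).
    { apply Rmult_le_reg_l with (2 * N ^ 2 * mu); [apply Rmult_lt_0_compat; lra|].
      replace (2 * N ^ 2 * mu * (y / N ^ 2)) with (2 * y * mu) by (field; lra).
      replace (2 * N ^ 2 * mu * (/ 2 * (y ^ 2 / (N ^ 2 * mu) + mu / N ^ 2)))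
        with (y ^ 2 + mu ^ 2) by (field; lra).
      assert (H := pow2_ge_0 (y - mu)). nra. }
    unfold Rdiv in *. lra.
Qed.

(** On the block of indices from 4^J to 4^(J+1) the arithmetic-geometric inequality with
    weight 2^J bounds the sum by a multiple of 2^-J, which is summable over the blocks. *)
Lemma ex_series_of_square_means (x : nat -> R) D :
  (forall k, 0 <= x k) ->
  (forall n, sum_n (fun k => x k ^ 2) n <= D * (INR n + 2) ^ 2) ->
  ex_series (fun k => x k / INR (S k) ^ 2).
Proof.
  intros Hx HD. set (u := fun k => x k / INR (S k) ^ 2).
  assert (HSp : forall k, 0 < INR (S k) ^ 2) by (intros; apply pow_lt, lt_0_INR; lia).
  assert (Hu : forall k, 0 <= u k) by (intros k; now apply Rdiv_le_0_compat).
  assert (HD0 : 0 <= D).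
  { specialize (HD O). rewrite sum_O in HD. simpl in HD. specialize (Hx O). nra. }
  set (K := 18 * D + 2).
  assert (Hblock : forall J, sum_n u (4 ^ S J) - sum_n u (4 ^ J) <= K * (/ 2) ^ J).
  { intros J. set (mu := 2 ^ J).
    assert (Hmu : 1 <= mu) by (apply pow_R1_Rle; lra).
    assert (HN : INR (4 ^ J) = mu ^ 2).
    { rewrite pow_INR. unfold mu. rewrite <- pow_mult, Nat.mul_comm, pow_mult.
      f_equal. simpl. ring. }
    replace (4 ^ S J)%nat with (4 ^ J + 3 * 4 ^ J)%nat by (simpl; lia).
    assert (HN1 : 1 <= mu ^ 2) by nra.
    eapply Rle_trans; [apply (block_sum_le x u (4 ^ J) (3 * 4 ^ J) (mu ^ 2) mu); [lra|lra|]|].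
    { intros k Hk. unfold u, Rdiv. apply Rmult_le_compat_l; [apply Hx|].
      apply Rinv_le_contravar; [apply pow_lt; lra|]. apply pow_incr.
      split; [lra|]. rewrite <- HN. apply le_INR; lia. }
    assert (H0 : 0 <= sum_n (fun k => x k ^ 2) (4 ^ J)).
    { eapply Rle_trans; [|apply (term_le_sum_n (fun k => x k ^ 2) 0)]; [|intros k|lia];
        apply pow2_ge_0. }
    assert (H1 := HD (4 ^ J + 3 * 4 ^ J)%nat).
    rewrite plus_INR, mult_INR, HN in *. simpl (INR 3) in *.
    set (T1 := sum_n _ (4 ^ J + 3 * 4 ^ J)) in *. set (T0 := sum_n _ (4 ^ J)) in *.
    replace ((/ 2) ^ J) with (/ mu) by (unfold mu; now rewrite pow_inv).
    replace (/ 2 * ((T1 - T0) / ((mu ^ 2) ^ 2 * mu)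
       + (1 + 1 + 1) * mu ^ 2 * (mu / (mu ^ 2) ^ 2)))
      with (/ 2 * ((T1 - T0) / mu ^ 4 + 3) * / mu) by (field; lra).
    apply Rmult_le_compat_r; [left; apply Rinv_0_lt_compat; lra|].
    assert (H4 : 0 < mu ^ 4) by (apply pow_lt; lra).
    assert (H2 : (T1 - T0) / mu ^ 4 <= 36 * D).
    { apply Rle_div_l; [exact H4|].
      replace (mu ^ 4) with (mu ^ 2 * mu ^ 2) by ring.
      assert ((mu ^ 2 + (1 + 1 + 1) * mu ^ 2 + 2) ^ 2 <= 36 * (mu ^ 2 * mu ^ 2)) by nra.
      nra. }
    unfold K. lra. }
  assert (Hpow : forall J, sum_n u (4 ^ J) <= sum_n u 1 + K * (2 - 2 * (/ 2) ^ J)).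
  { induction J as [|J IH].
    - simpl (4 ^ 0)%nat. simpl (_ ^ 0). lra.
    - specialize (Hblock J). simpl ((/ 2) ^ S J). lra. }
  apply ex_series_of_bounded with (sum_n u 1 + K * 2); [exact Hu|]. intros n.
  apply Rle_trans with (sum_n u (4 ^ n)).
  - apply sum_n_nonneg_le; [exact Hu|]. apply Nat.lt_le_incl, Nat.pow_gt_lin_r; lia.
  - eapply Rle_trans; [apply Hpow|]. assert (0 <= (/ 2) ^ n) by (apply pow_le; lra).
    assert (0 <= K) by (unfold K; lra). nra.
Qed.

Lemma exp_pow_INR (x : R) (n : nat) : exp x ^ n = exp (INR n * x).
Proof.
  induction n as [|n IH]; [simpl; now rewrite Rmult_0_l, exp_0|].
  rewrite S_INR, Rmult_plus_distr_r, Rmult_1_l, exp_plus, <- IH. simpl. ring.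
Qed.

Definition derivative_bound (f : C -> C) (beta : R) : Prop :=
  forall z, disk z -> (1 - Cmod z ^ 2) * Cmod (C_derive f z) <= beta.

Section Bloch.

Variables (a : nat -> C) (f : C -> C) (beta : R).
Hypothesis Hf : power_series_on_disk a f.
Hypothesis Hbeta : derivative_bound f beta.

Lemma derivative_bound_nonneg : 0 <= beta.
Proof.
  eapply Rle_trans; [|apply (Hbeta (RtoC 0))]; [|unfold disk; rewrite Cmod_0; lra].
  rewrite Cmod_0. assert (H := Cmod_ge_0 (C_derive f 0)). lra.
Qed.

(** Bessel's inequality for f' on the circle of radius r = 1 - 1/(n+2): there |f'| is at most
    beta (n+2), while r^(2k) stays above exp(-2) for k up to n. *)
Lemma derived_coef_square_mean n :
  sum_n (fun k => Cmod (derived_coef a k) ^ 2) n <= 9 * beta ^ 2 * (INR n + 2) ^ 2.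
Proof.
  assert (Hb := derivative_bound_nonneg).
  set (x := INR n + 2). assert (Hx : 2 <= x) by (unfold x; generalize (pos_INR n); lra).
  set (r := 1 - / x).
  assert (Hix : 0 < / x <= / 2).
  { split; [apply Rinv_0_lt_compat; lra|]. apply Rinv_le_contravar; lra. }
  assert (Hr : 0 < r < 1) by (unfold r; lra).
  assert (Hd : expansion_within (derived_coef a) (C_derive f) 1).
  { intros z Hz. now apply C_derive_power_series. }
  destruct (expansion_coef_bound _ _ 1 ((r + 1) / 2) Hd) as [M [_ HM]]; [lra|].
  assert (HB := bessel_circle (derived_coef a) r (beta * x) ltac:(lra)
    (pseries_abs_conv _ ((r + 1) / 2) M r ltac:(lra) HM)).
  assert (Hr2 : forall k, (k <= n)%nat -> / 9 <= r ^ (2 * k)).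
  { intros k Hk.
    assert (He : / r <= exp (/ (x - 1))).
    { replace (/ r) with (1 + / (x - 1)) by (unfold r; field; lra). apply exp_ineq1_le. }
    assert (Hp : (/ r) ^ (2 * k) <= 9).
    { apply Rle_trans with (exp (/ (x - 1)) ^ (2 * k)).
      - apply pow_incr. split; [left; apply Rinv_0_lt_compat; lra|exact He].
      - rewrite exp_pow_INR. apply Rle_trans with (exp (1 + 1)).
        + assert (Hk' : INR (2 * k) * / (x - 1) <= 1 + 1).
          { apply Rle_div_l; [lra|]. rewrite mult_INR. simpl (INR 2).
            assert (INR k <= INR n) by now apply le_INR. unfold x. lra. }
          destruct (Rle_lt_or_eq_dec _ _ Hk') as [H|H];
            [left; now apply exp_increasing|rewrite H; lra].
        + rewrite exp_plus. assert (H3 := exp_le_3). assert (H0 := exp_pos 1). nra. }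
    rewrite pow_inv in Hp.
    assert (Hrp : 0 < r ^ (2 * k)) by (apply pow_lt; lra).
    rewrite <- (Rinv_inv (r ^ (2 * k))).
    apply Rinv_le_contravar; [now apply Rinv_0_lt_compat|exact Hp]. }
  apply Rle_trans with (9 * sum_n (fun k => Cmod (derived_coef a k) ^ 2 * r ^ (2 * k)) n).
  - rewrite <- Rsum_mult_l. apply sum_n_Rle. intros k Hk.
    specialize (Hr2 k Hk). assert (H := pow2_ge_0 (Cmod (derived_coef a k))). nra.
  - replace (9 * beta ^ 2 * x ^ 2) with (9 * (beta * x) ^ 2) by ring.
    apply Rmult_le_compat_l; [lra|]. apply HB. intros z Hz.
    assert (Hdz : disk z) by (unfold disk; lra).
    rewrite (pseries_sum_unique _ _ _ (Hd z Hdz)).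
    assert (H := Hbeta z Hdz). rewrite Hz in H.
    assert (H1 : / x <= 1 - r ^ 2) by (unfold r in *; nra).
    assert (Hc := Cmod_ge_0 (C_derive f z)).
    replace (Cmod (C_derive f z)) with (/ x * Cmod (C_derive f z) * x) by (field; lra).
    apply Rmult_le_compat_r; [lra|]. nra.
Qed.

(** The coefficients of a Bloch function need not tend to zero, so their size alone does not
    give convergence of the inner series of the Hilbert operator; the square means do. *)
Lemma bloch_coef_summable : ex_series (fun k => Cmod (a k) / INR (S k)).
Proof.
  apply ex_series_incr_1.
  apply (@ex_series_le R_AbsRing R_CompleteNormedModule _
    (fun k => Cmod (derived_coef a k) / INR (S k) ^ 2)).
  - intros k. change norm with Rabs.
    assert (H1 : 0 < INR (S k)) by (apply lt_0_INR; lia).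
    assert (H2 : INR (S k) <= INR (S (S k))) by (apply le_INR; lia).
    rewrite Rabs_pos_eq by (apply Rdiv_le_0_compat; [apply Cmod_ge_0|lra]).
    unfold derived_coef. rewrite Cmod_mult, Cmod_R, Rabs_pos_eq by lra.
    replace (INR (S k) * Cmod (a (S k)) / INR (S k) ^ 2)
      with (Cmod (a (S k)) * / INR (S k)) by (field; lra).
    apply Rmult_le_compat_l; [apply Cmod_ge_0|]. apply Rinv_le_contravar; lra.
  - apply ex_series_of_square_means with (9 * beta ^ 2).
    + intros; apply Cmod_ge_0.
    + apply derived_coef_square_mean.
Qed.

End Bloch.

Lemma hilbert_exists a f :
  power_series_on_disk a f -> ex_series (fun k => Cmod (a k) / INR (S k)) ->
  exists b g, (forall n,
      is_series (fun k => (a k / RtoC (INR (n + k + 1)))%C) (b n)) /\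
    power_series_on_disk b g.
Proof.
  intros Hf [L HL].
  assert (Hle : forall n k, Cmod (a k / RtoC (INR (n + k + 1)))%C <= Cmod (a k) / INR (S k)).
  { intros n k.
    assert (H1 : 0 < INR (S k)) by (apply lt_0_INR; lia).
    assert (H2 : INR (S k) <= INR (n + k + 1)) by (apply le_INR; lia).
    rewrite Cmod_div by (intros E; apply RtoC_inj in E; lra).
    rewrite Cmod_R, Rabs_pos_eq by lra.
    apply Rmult_le_compat_l; [apply Cmod_ge_0|]. apply Rinv_le_contravar; lra. }
  set (b := fun n => CSeries (fun k => (a k / RtoC (INR (n + k + 1)))%C)).
  assert (Hb : forall n, is_series (fun k => (a k / RtoC (INR (n + k + 1)))%C) (b n)).
  { intros n. apply CSeries_correct.
    apply (@ex_series_le R_AbsRing R_CompleteNormedModule _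
             (fun k => Cmod (a k) / INR (S k))); [|now exists L].
    intros k. change norm with Rabs. rewrite Rabs_pos_eq by apply Cmod_ge_0. apply Hle. }
  exists b, (pseries_sum b). split; [exact Hb|]. intros z Hz.
  apply pseries_sum_correct, (pseries_abs_conv b 1 L).
  - split; [apply Cmod_ge_0|exact Hz].
  - intros n. rewrite pow1, Rmult_1_r.
    exact (Cmod_is_series_le _ _ _ _ (Hb n) HL (Hle n)).
Qed.

(** * Moments of a Bloch function on the radius *)
Lemma nonneg_derive_le (F dF : R -> R) t :
  0 <= t -> (forall x, 0 <= x <= t -> is_derive F x (dF x)) ->
  (forall x, 0 <= x <= t -> 0 <= dF x) -> F 0 <= F t.
Proof.
  intros Ht HF HdF.
  destruct (MVT_gen F 0 t dF) as (c & Hc & E).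
  - intros x Hx. rewrite Rmin_left, Rmax_right in Hx by lra. apply HF; lra.
  - intros x Hx. rewrite Rmin_left, Rmax_right in Hx by lra.
    apply derivable_continuous_pt. exists (dF x). apply is_derive_Reals, HF; lra.
  - rewrite Rmin_left, Rmax_right in Hc by lra. specialize (HdF c Hc). nra.
Qed.

(** The primitive of 1/(1 - t^2) vanishing at 0: beta times it bounds |f(t) - f(0)| when
    beta is the Bloch seminorm of f. *)
Definition bloch_majorant (t : R) : R := (ln (1 + t) - ln (1 - t)) / 2.

Lemma is_derive_bloch_majorant t :
  -1 < t < 1 -> is_derive bloch_majorant t (/ (1 - t ^ 2)).
Proof.
  intros Ht. unfold bloch_majorant. auto_derive; [lra|]. field. nra.
Qed.

Lemma bloch_majorant_nonneg t : 0 <= t < 1 -> 0 <= bloch_majorant t.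
Proof.
  intros Ht. unfold bloch_majorant. assert (ln (1 - t) <= ln (1 + t)); [|lra].
  destruct (Req_dec t 0) as [->|H]; [right; f_equal; ring|].
  left; apply ln_increasing; lra.
Qed.

(** The integral of (1 - s^(n+1)) / (1 - s^2) over [0,t]. *)
Fixpoint moment_sum (n : nat) (t : R) : R :=
  match n with
  | O => ln (1 + t)
  | 1%nat => t
  | S (S m) => moment_sum m t + t ^ (S (S m)) / INR (S (S m))
  end.

Lemma nat_ind2 (P : nat -> Prop) :
  P 0%nat -> P 1%nat -> (forall n, P n -> P (S n) -> P (S (S n))) -> forall n, P n.
Proof.
  intros H0 H1 HS n. enough (P n /\ P (S n)) by tauto.
  induction n as [|n [IH1 IH2]]; [tauto|]. split; [exact IH2|now apply HS].
Qed.

Lemma is_derive_pow_div k t : is_derive (fun t => t ^ S k / INR (S k)) t (t ^ k).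
Proof.
  assert (Hk : INR (S k) <> 0) by (apply not_0_INR; lia).
  apply (is_derive_ext (fun t => / INR (S k) * t ^ S k)); [intros x; apply Rmult_comm|].
  replace (t ^ k) with (/ INR (S k) * (INR (S k) * 1 * t ^ k)) by (field; exact Hk).
  apply is_derive_scal, (is_derive_pow (fun t => t) (S k) t 1).
  exact (@is_derive_id R_AbsRing t).
Qed.

Lemma is_derive_moment_sum n t :
  -1 < t < 1 -> is_derive (moment_sum n) t ((1 - t ^ S n) / (1 - t ^ 2)).
Proof.
  intros Ht. induction n as [| |n IH _] using nat_ind2.
  - simpl moment_sum. auto_derive; [lra|]. field. nra.
  - simpl moment_sum. auto_derive; [trivial|]. field. nra.
  - assert (Hn : INR (S (S n)) <> 0) by (apply not_0_INR; lia).
    change (moment_sum (S (S n)))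
      with (fun t => moment_sum n t + t ^ S (S n) / INR (S (S n))).
    replace ((1 - t ^ S (S (S n))) / (1 - t ^ 2))
      with ((1 - t ^ S n) / (1 - t ^ 2) + t ^ S n) by (simpl; field; nra).
    apply (is_derive_plus (moment_sum n)); [exact IH|].
    apply is_derive_pow_div.
Qed.

Lemma moment_sum_incr n t : 0 <= t <= 1 -> 0 <= moment_sum n t <= moment_sum n 1.
Proof.
  intros Ht. induction n as [| |n IH _] using nat_ind2.
  - simpl. split.
    + rewrite <- ln_1. destruct (Req_dec t 0) as [->|H]; [right; f_equal; ring|].
      left; apply ln_increasing; lra.
    + destruct (Req_dec t 1) as [->|H]; [lra|]. left; apply ln_increasing; lra.
  - simpl. lra.
  - change (0 <= moment_sum n t + t ^ S (S n) / INR (S (S n))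
            <= moment_sum n 1 + 1 ^ S (S n) / INR (S (S n))).
    assert (Hn : 0 < / INR (S (S n))) by (apply Rinv_0_lt_compat, lt_0_INR; lia).
    assert (0 <= t ^ S (S n)) by (apply pow_le; lra).
    assert (t ^ S (S n) <= 1 ^ S (S n)) by (apply pow_incr; lra).
    unfold Rdiv. split; [|apply Rplus_le_compat; [lra|apply Rmult_le_compat_r; lra]].
    assert (0 <= t ^ S (S n) * / INR (S (S n))) by (apply Rmult_le_pos; lra). lra.
Qed.

(** The integral of s^n times the Bloch majorant over [0,t], by parts with the primitive
    (s^(n+1) - 1) / (n+1), which cancels the singularity of the majorant at 1. *)
Definition majorant_moment (n : nat) (t : R) : R :=
  ((t ^ S n - 1) * bloch_majorant t + moment_sum n t) / INR (S n).

Lemma is_derive_majorant_moment n t :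
  -1 < t < 1 -> is_derive (majorant_moment n) t (t ^ n * bloch_majorant t).
Proof.
  intros Ht. assert (Hn : INR (S n) <> 0) by (apply not_0_INR; lia).
  assert (H1 := is_derive_bloch_majorant t Ht).
  assert (H2 := is_derive_moment_sum n t Ht).
  unfold majorant_moment.
  apply (is_derive_ext (fun t => / INR (S n) * ((t ^ S n - 1) * bloch_majorant t + moment_sum n t)));
    [intros x; unfold majorant_moment, Rdiv; apply Rmult_comm|].
  replace (t ^ n * bloch_majorant t) with (/ INR (S n) *
     ((INR (S n) * t ^ n * bloch_majorant t + (t ^ S n - 1) * / (1 - t ^ 2))
      + (1 - t ^ S n) / (1 - t ^ 2))) by (field; split; [nra|exact Hn]).
  apply is_derive_scal. apply (is_derive_plus (fun t => (t ^ S n - 1) * bloch_majorant t));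
    [|exact H2].
  apply (is_derive_mult (fun t => t ^ S n - 1) bloch_majorant);
    [|exact H1|intros; apply Rmult_comm].
  apply (is_derive_ext (fun t => INR (S n) * (t ^ S n / INR (S n)) - 1)).
  - intros x. real_eq. field. exact Hn.
  - replace (INR (S n) * t ^ n) with (INR (S n) * t ^ n - 0) by ring.
    apply (is_derive_minus (fun t => INR (S n) * (t ^ S n / INR (S n)))).
    + apply is_derive_scal, is_derive_pow_div.
    + exact (@is_derive_const R_AbsRing R_NormedModule 1 t).
Qed.

Lemma majorant_moment_0 n : majorant_moment n 0 = 0.
Proof.
  unfold majorant_moment, bloch_majorant. rewrite Rplus_0_r, Rminus_0_r, ln_1.
  assert (E : moment_sum n 0 = 0).
  { induction n as [| |n IH _] using nat_ind2.
    - simpl. now rewrite Rplus_0_r, ln_1.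
    - reflexivity.
    - change (moment_sum n 0 + 0 ^ S (S n) / INR (S (S n)) = 0).
      rewrite IH, pow_i by lia. unfold Rdiv. ring. }
  rewrite E. unfold Rdiv. ring.
Qed.

Lemma majorant_moment_le n t : 0 <= t < 1 -> majorant_moment n t <= moment_sum n 1 / INR (S n).
Proof.
  intros Ht. unfold majorant_moment, Rdiv.
  apply Rmult_le_compat_r; [left; apply Rinv_0_lt_compat, lt_0_INR; lia|].
  assert (H1 := bloch_majorant_nonneg t Ht).
  assert (H2 := moment_sum_incr n t ltac:(lra)).
  assert (t ^ S n <= 1 ^ S n) by (apply pow_incr; lra). rewrite pow1 in H. nra.
Qed.

Lemma CV_radius_ge_1 (c : nat -> R) :
  (forall t, 0 <= t < 1 -> exists M, forall n, Rabs (c n * t ^ n) <= M) ->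
  Rbar_le 1 (CV_radius c).
Proof.
  intros H. destruct (CV_radius_bounded c) as [Hub _].
  apply Rbar_not_lt_le. intros Hlt.
  assert (H0 : Rbar_le 0 (CV_radius c)) by apply CV_radius_ge_0.
  destruct (CV_radius c) as [rho| |]; simpl in *; try contradiction; try lra.
  assert (H1 := Hub ((1 + rho) / 2) (H ((1 + rho) / 2) ltac:(lra))). simpl in H1. lra.
Qed.

Lemma CV_radius_abs_conv (c : nat -> R) :
  ex_series (fun k => Rabs (c k)) -> Rbar_le 1 (CV_radius c).
Proof.
  intros [L HL]. apply CV_radius_ge_1. intros t Ht. exists L. intros n.
  rewrite Rabs_mult, (Rabs_pos_eq (t ^ n)) by (apply pow_le; lra).
  assert (H1 : Rabs (c n) <= L).
  { eapply Rle_trans; [|apply (sum_n_le_is_series (fun k => Rabs (c k)) L n); [|exact HL]].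
    - apply (term_le_sum_n (fun k => Rabs (c k))); [intros; apply Rabs_pos|lia].
    - intros; apply Rabs_pos. }
  assert (H2 : t ^ n <= 1 ^ n) by (apply pow_incr; lra). rewrite pow1 in H2.
  assert (0 <= t ^ n) by (apply pow_le; lra). assert (H0 := Rabs_pos (c n)). nra.
Qed.

(** Abel's theorem when the radius of convergence is 1, continuity when it is larger. *)
Lemma Series_le_of_PSeries_le (c : nat -> R) B :
  ex_series (fun k => Rabs (c k)) ->
  (forall t, 0 <= t < 1 -> PSeries c t <= B) -> Series c <= B.
Proof.
  intros Hc HB.
  assert (Hr : Rbar_le 1 (CV_radius c)).
  { now apply CV_radius_abs_conv. }
  assert (Hlim : filterlim (PSeries c) (at_left 1) (locally (PSeries c 1))).
  { destruct (Rbar_le_lt_or_eq_dec _ _ Hr) as [Hlt|Heq].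
    - assert (Hcont : continuous (PSeries c) 1)
        by (apply continuity_pt_filterlim, PSeries_continuity; now rewrite Rabs_pos_eq by lra).
      intros P HP. specialize (Hcont P HP). revert Hcont.
      unfold filtermap, at_left, within. apply filter_imp. auto.
    - assert (Habel := Abel c). rewrite <- Heq in Habel. apply Habel.
      + simpl; lra.
      + exact I.
      + apply ex_pseries_1, ex_series_Rabs, Hc. }
  rewrite <- PSeries_1.
  apply (filterlim_le (F := at_left 1) (PSeries c) (fun _ => B) (PSeries c 1) B).
  - assert (H0 : locally 1 (fun y : R => 0 < y)) by (apply (open_gt 0); lra).
    unfold at_left, within. revert H0. apply filter_imp. intros y Hy0 Hy1. apply HB. lra.
  - exact Hlim.
  - apply filterlim_const.
Qed.

(** The left-hand side is the integral of t^n p(t) over the unit interval, where p is the sum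
    of the series with coefficients c. Comparing derivatives twice, first p and then the
    primitive of t^n p(t) are bounded by the same constructions applied to beta times the
    majorant; the bound passes to the endpoint 1. *)
Lemma real_moment_bound (c : nat -> R) beta n :
  c 0%nat = 0 -> 0 <= beta ->
  ex_series (fun k => Rabs (c k) / INR (S k)) ->
  (forall t, 0 <= t < 1 -> exists M, forall n, Rabs (c n * t ^ n) <= M) ->
  (forall t, 0 <= t < 1 -> PSeries (PS_derive c) t <= beta / (1 - t ^ 2)) ->
  Series (fun k => c k / INR (n + k + 1)) <= beta * (moment_sum n 1 / INR (S n)).
Proof.
  intros Hc0 Hb Hsum Hbnd Hder.
  assert (Hr := CV_radius_ge_1 c Hbnd).
  assert (Hin : forall t (d : nat -> R), Rbar_le 1 (CV_radius d) -> 0 <= t < 1 ->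
     Rbar_lt (Rabs t) (CV_radius d)).
  { intros t d Hd Ht. rewrite Rabs_pos_eq by lra.
    eapply Rbar_lt_le_trans; [|exact Hd]. simpl; lra. }
  assert (Hp : forall t, 0 <= t < 1 -> PSeries c t <= beta * bloch_majorant t).
  { intros t Ht.
    assert (H := nonneg_derive_le
      (fun t => beta * bloch_majorant t - PSeries c t)
      (fun t => beta * / (1 - t ^ 2) - PSeries (PS_derive c) t) t ltac:(lra)).
    cbv beta in H.
    assert (E0 : bloch_majorant 0 = 0)
      by (unfold bloch_majorant; rewrite Rplus_0_r, Rminus_0_r; lra).
    rewrite E0, PSeries_0, Hc0 in H.
    enough (beta * 0 - 0 <= beta * bloch_majorant t - PSeries c t) by lra.
    apply H.
    - intros x Hx. apply (is_derive_minus (fun t => beta * bloch_majorant t) (PSeries c)).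
      + apply is_derive_scal, is_derive_bloch_majorant; lra.
      + apply is_derive_PSeries, Hin; [exact Hr|lra].
    - intros x Hx. specialize (Hder x ltac:(lra)). unfold Rdiv in Hder. lra. }
  (* the coefficients of the primitive of t^n p(t) *)
  set (g := PS_incr_n (fun k => c k / INR (n + k + 1)) (S n)).
  assert (Hg : forall k, g (S n + k)%nat = c k / INR (n + k + 1)).
  { intros k. unfold g. rewrite PS_incr_n_simplify.
    destruct (le_lt_dec (S n) (S n + k)) as [_|H]; [|lia].
    now replace (S n + k - S n)%nat with k by lia. }
  assert (Hg0 : forall k, (k < S n)%nat -> g k = 0).
  { intros k Hk. unfold g. rewrite PS_incr_n_simplify.
    destruct (le_lt_dec (S n) k) as [H|_]; [lia|reflexivity]. }
  assert (Hgd : forall k, PS_derive g k = PS_incr_n c n k).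
  { intros k. unfold PS_derive. rewrite PS_incr_n_simplify.
    destruct (le_lt_dec n k) as [H|H].
    - replace (S k) with (S n + (k - n))%nat at 2 by lia. rewrite Hg.
      replace (n + (k - n) + 1)%nat with (S k) by lia. field.
      apply not_0_INR; lia.
    - rewrite Hg0 by lia. change zero with 0. ring. }
  assert (Hgabs : ex_series (fun k => Rabs (g k))).
  { apply (ex_series_incr_n _ (S n)).
    apply (@ex_series_le R_AbsRing R_CompleteNormedModule _
             (fun k => Rabs (c k) / INR (S k))); [|exact Hsum].
    intros k. change norm with Rabs. rewrite Rabs_Rabsolu, Hg.
    assert (H1 : 0 < INR (S k)) by (apply lt_0_INR; lia).
    assert (H2 : INR (S k) <= INR (n + k + 1)) by (apply le_INR; lia).
    unfold Rdiv. rewrite Rabs_mult, (Rabs_pos_eq (/ _)) by (left; apply Rinv_0_lt_compat; lra).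
    apply Rmult_le_compat_l; [apply Rabs_pos|]. apply Rinv_le_contravar; lra. }
  rewrite <- (Series_ext _ _ Hg), <- (Series_incr_n_aux g (S n) Hg0).
  apply Series_le_of_PSeries_le; [exact Hgabs|]. intros t Ht.
  assert (Hrg : Rbar_le 1 (CV_radius g)).
  { now apply CV_radius_abs_conv. }
  apply Rle_trans with (beta * majorant_moment n t);
    [|apply Rmult_le_compat_l; [exact Hb|now apply majorant_moment_le]].
  assert (H := nonneg_derive_le
      (fun t => beta * majorant_moment n t - PSeries g t)
      (fun t => beta * (t ^ n * bloch_majorant t) - PSeries (PS_derive g) t) t ltac:(lra)).
  cbv beta in H. rewrite majorant_moment_0, PSeries_0, Hg0 in H by lia.
  enough (beta * 0 - 0 <= beta * majorant_moment n t - PSeries g t) by lra.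
  apply H.
  - intros x Hx. apply (is_derive_minus (fun t => beta * majorant_moment n t) (PSeries g)).
    + apply is_derive_scal, is_derive_majorant_moment; lra.
    + apply is_derive_PSeries, Hin; [exact Hrg|lra].
  - intros x Hx. rewrite (PSeries_ext _ _ _ Hgd), PSeries_incr_n.
    specialize (Hp x ltac:(lra)). assert (0 <= x ^ n) by (apply pow_le; lra). nra.
Qed.

Lemma RtoC_INR_neq_0 n : RtoC (INR (S n)) <> 0%C.
Proof. intros E. apply RtoC_inj in E. revert E. apply not_0_INR; lia. Qed.

(** After a rotation of f that makes the quantity to be bounded a positive real, only real
    parts of coefficients matter, and f' is only needed on the real radius. *)
Lemma hilbert_coef_bound a f beta n bn :
  power_series_on_disk a f -> derivative_bound f beta ->
  is_series (fun k => (a k / RtoC (INR (n + k + 1)))%C) bn ->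
  Cmod (bn - a 0%nat / RtoC (INR (S n)))%C <= beta * (moment_sum n 1 / INR (S n)).
Proof.
  intros Hf Hbeta Hb.
  assert (Hb0 := derivative_bound_nonneg f beta Hbeta).
  set (v := (bn - a 0%nat / RtoC (INR (S n)))%C).
  destruct (Req_dec (Cmod v) 0) as [Hv|Hv].
  { rewrite Hv. apply Rmult_le_pos; [exact Hb0|].
    apply Rdiv_le_0_compat; [apply moment_sum_incr; lra|apply lt_0_INR; lia]. }
  assert (Hvp : 0 < Cmod v) by (generalize (Cmod_ge_0 v); lra).
  set (u := (Cconj v * RtoC (/ Cmod v))%C).
  assert (Hu : Cmod u = 1).
  { unfold u. rewrite Cmod_mult, Cmod_conj, Cmod_R, Rabs_pos_eq
      by (left; now apply Rinv_0_lt_compat). field; lra. }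
  assert (Huv : Re (u * v)%C = Cmod v).
  { replace (u * v)%C with (RtoC (/ Cmod v) * (v * Cconj v))%C by (unfold u; ring).
    rewrite <- Cmod2_conj, <- RtoC_mult. simpl. field; lra. }
  set (c := fun k => match k with O => 0 | S _ => Re (u * a k)%C end).
  assert (Hca : forall k, Rabs (c k) <= Cmod (a k)).
  { intros [|k]; unfold c; [rewrite Rabs_R0; apply Cmod_ge_0|].
    eapply Rle_trans; [apply re_le_Cmod|]. rewrite Cmod_mult, Hu. lra. }
  assert (Hser : is_series (fun k => c k / INR (n + k + 1)) (Cmod v)).
  { rewrite <- Huv.
    assert (H := is_series_tail _ _ 0 Hb). rewrite sum_O in H.
    apply (is_Cseries_scal u) in H.
    apply is_series_Re in H. apply is_series_decr_1.
    assert (E0 : Re (u * v)%C + - (c 0%nat / INR (n + 0 + 1)) = Re (u * v)%C)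
      by (unfold c, Rdiv; ring).
    change (is_series (fun k => c (S k) / INR (n + S k + 1))
              (Re (u * v)%C + - (c 0%nat / INR (n + 0 + 1)))).
    rewrite E0.
    replace (n + 0 + 1)%nat with (S n) in H by lia.
    eapply is_series_ext; [|exact H]. intros k. cbv beta.
    change (1 + k)%nat with (S k).
    assert (Hk : INR (n + S k + 1) <> 0) by (apply not_0_INR; lia).
    replace (u * (a (S k) / INR (n + S k + 1)))%C
      with (u * a (S k) * RtoC (/ INR (n + S k + 1)))%C
      by (rewrite RtoC_inv by exact Hk; unfold Cdiv; ring).
    unfold c, Rdiv. set (w := (u * a (S k))%C). destruct w; simpl. ring. }
  rewrite <- (is_series_unique _ _ Hser).
  apply real_moment_bound; [reflexivity|exact Hb0| | |].
  - apply (@ex_series_le R_AbsRing R_CompleteNormedModule _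
      (fun k => Cmod (a k) / INR (S k))); [|now apply (bloch_coef_summable a f beta)].
    intros k. change norm with Rabs.
    assert (H1 : 0 < INR (S k)) by (apply lt_0_INR; lia).
    rewrite Rabs_pos_eq by (apply Rdiv_le_0_compat; [apply Rabs_pos|exact H1]).
    apply Rmult_le_compat_r; [left; now apply Rinv_0_lt_compat|apply Hca].
  - intros t Ht. destruct (expansion_coef_bound a f 1 t Hf Ht) as [M [_ HM]].
    exists M. intros k. rewrite Rabs_mult, (Rabs_pos_eq (t ^ k)) by (apply pow_le; lra).
    eapply Rle_trans; [apply Rmult_le_compat_r; [apply pow_le; lra|apply Hca]|apply HM].
  - intros t Ht.
    assert (Htd : disk (RtoC t)) by (unfold disk; rewrite Cmod_R, Rabs_pos_eq; lra).
    assert (Hd := proj1 (is_pseries_C _ _ _) (C_derive_power_series a f t Hf Htd)).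
    apply (is_Cseries_scal u) in Hd. apply is_series_Re in Hd.
    assert (E : PSeries (PS_derive c) t = Re (u * C_derive f t)%C).
    { apply is_series_unique. eapply is_series_ext; [|exact Hd].
      intros k. cbv beta. unfold PS_derive, c, derived_coef.
      rewrite <- RtoC_pow.
      replace (u * (INR (S k) * a (S k) * (t ^ k)%R))%C
        with (u * a (S k) * RtoC (INR (S k) * t ^ k))%C by (rewrite RtoC_mult; ring).
      set (w := (u * a (S k))%C). destruct w as [w1 w2].
      unfold Re, Cmult, RtoC; cbn [fst snd]. real_eq. ring. }
    rewrite E.
    assert (H := Hbeta t Htd). rewrite Cmod_R, Rabs_pos_eq in H by lra.
    apply Rle_div_r; [nra|].
    assert (H1 := re_le_Cmod (u * C_derive f t)%C). rewrite Cmod_mult, Hu, Rmult_1_l in H1.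
    assert (H2 := Rle_abs (Re (u * C_derive f t)%C)).
    eapply Rle_trans; [|exact H]. rewrite Rmult_comm.
    apply Rmult_le_compat_l; [nra|lra].
Qed.

(** * Coefficient comparison with the logarithmic weight *)
Lemma ln_2_le : ln 2 <= 3 / 4.
Proof.
  rewrite <- (ln_exp (3 / 4)). apply ln_le; [lra|].
  replace (3 / 4) with (INR 6 * (1 / 8)) by (simpl; field).
  rewrite <- exp_pow_INR.
  (* (9/8)^6 is about 2.03 *)
  apply Rle_trans with ((1 + 1 / 8) ^ 6); [simpl; lra|].
  apply pow_incr. split; [lra|]. apply exp_ineq1_le.
Qed.

(** The coefficients of (1 - 2 ln (1-x)) / (1 - x^2): the numerator is
    ln (e / (1-x)^2), with coefficients 1 and 2/k for positive k, and division by 1 - x^2 sums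
    them with step 2. *)
Fixpoint log_weight_sum (n : nat) : R :=
  match n with
  | O => 1
  | 1%nat => 2
  | S (S m) => log_weight_sum m + 2 / INR (S (S m))
  end.

Lemma log_weight_sum_SS n : log_weight_sum (S (S n)) = log_weight_sum n + 2 / INR (S (S n)).
Proof. reflexivity. Qed.

Lemma log_weight_sum_S_ge n : 2 <= log_weight_sum (S n).
Proof.
  induction n as [| |n IH _] using nat_ind2; [simpl; lra|simpl; lra|].
  rewrite log_weight_sum_SS.
  assert (0 < 2 / INR (S (S (S n)))) by (apply Rdiv_lt_0_compat; [lra|apply lt_0_INR; lia]).
  lra.
Qed.

Lemma log_weight_sum_nonneg n : 0 <= log_weight_sum n.
Proof.
  destruct n as [|n]; [simpl; lra|]. assert (H := log_weight_sum_S_ge n). lra.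
Qed.

Lemma moment_sum_1_le n : moment_sum n 1 <= 1 + (1 - ln 2) * (INR n + 1).
Proof.
  assert (Hln := ln_2_le).
  induction n as [| |n IH _] using nat_ind2.
  - simpl. replace (1 + 1) with 2 by ring. lra.
  - simpl. lra.
  - change (moment_sum (S (S n)) 1)
      with (moment_sum n 1 + 1 ^ S (S n) / INR (S (S n))).
    rewrite pow1, !S_INR. assert (H0 := pos_INR n).
    assert (H : 1 / (INR n + 1 + 1) <= 1 / 2).
    { unfold Rdiv. rewrite !Rmult_1_l. apply Rinv_le_contravar; lra. }
    nra.
Qed.

(** The left-hand side is the n-th coefficient of the derivative of the image of the constant
    function 1; equality at n = 0 reflects that this function is extremal. *)
Lemma constant_part_le n : INR (S n) / INR (S (S n)) <= / 2 * log_weight_sum n.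
Proof.
  destruct n as [|n]; [simpl; lra|]. assert (H := log_weight_sum_S_ge n).
  apply Rle_trans with 1; [|lra]. rewrite !S_INR. assert (H0 := pos_INR n).
  apply Rle_div_l; lra.
Qed.

(** The contribution of the Bloch seminorm to the derivative leaves room: the constant
    3/2 - ln 2 is what remains of 3/2 once the seminorm has contributed ln 2 to |g(0)|. The
    comparison is by induction with step 2, following the recursion of both sides. *)
Lemma bloch_part_le n :
  INR (S n) / INR (S (S n)) * moment_sum (S n) 1 <= (3 / 2 - ln 2) * log_weight_sum n.
Proof.
  assert (Hln := ln_2_le).
  induction n as [| |n IH _] using nat_ind2.
  - simpl. lra.
  - replace (moment_sum 2 1) with (ln 2 + / 2)
      by (simpl; replace (1 + 1) with 2 by ring; field).
    simpl. lra.
  - rewrite log_weight_sum_SS.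
    change (moment_sum (S (S (S n))) 1)
      with (moment_sum (S n) 1 + 1 ^ S (S (S n)) / INR (S (S (S n)))).
    assert (He := moment_sum_1_le (S n)).
    rewrite pow1 in *. rewrite !S_INR in *.
    set (e := moment_sum (S n) 1) in *. set (x := INR n) in *.
    assert (Hx : 0 <= x) by apply pos_INR.
    assert (E : (x + 1 + 1 + 1) / (x + 1 + 1 + 1 + 1) * (e + 1 / (x + 1 + 1 + 1)) =
      (x + 1) / (x + 1 + 1) * e + (2 * e + (x + 2)) / ((x + 2) * (x + 4)))
      by (field; lra).
    rewrite E, (Rmult_plus_distr_l (3 / 2 - ln 2)). apply Rplus_le_compat; [exact IH|].
    apply Rle_div_l; [nra|].
    replace ((3 / 2 - ln 2) * (2 / (x + 1 + 1)) * ((x + 2) * (x + 4)))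
      with ((3 - 2 * ln 2) * (x + 4)) by (field; lra).
    nra.
Qed.

Lemma log_partial_sum_le x N : 0 <= x < 1 ->
  sum_n (fun k => x ^ S k / INR (S k)) N <= - ln (1 - x).
Proof.
  intros Hx.
  assert (H := nonneg_derive_le
    (fun x => - ln (1 - x) - sum_n (fun k => x ^ S k / INR (S k)) N)
    (fun x => / (1 - x) - sum_n (fun k => x ^ k) N) x ltac:(lra)).
  cbv beta in H.
  assert (E0 : sum_n (fun k => 0 ^ S k / INR (S k)) N = 0 :> R).
  { clear. induction N as [|N IH].
    - rewrite sum_O. simpl. field.
    - rewrite Rsum_Sn, IH, pow_i by lia. unfold Rdiv. ring. }
  rewrite E0, (Rminus_0_r 1), ln_1 in H.
  enough (- 0 - 0 <= - ln (1 - x) - sum_n (fun k => x ^ S k / INR (S k)) N) by lra.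
  apply H.
  - intros y Hy.
    apply (is_derive_minus (fun x => - ln (1 - x)) (fun x => sum_n (fun k => x ^ S k / INR (S k)) N)).
    + auto_derive; [lra|]. field; lra.
    + apply (is_derive_sum_n (fun k x => x ^ S k / INR (S k))).
      intros k _. apply is_derive_pow_div.
  - intros y Hy.
    assert (Hg : sum_n (fun k => y ^ k) N <= / (1 - y)); [|lra].
    apply sum_n_le_is_series; [intros; apply pow_le; lra|].
    apply is_series_geom. rewrite Rabs_pos_eq; lra.
Qed.

(** Multiplication by 1 - x^2 telescopes the step-2 sums up to two negative boundary terms. *)
Lemma log_weight_partial_sum x N : 0 <= x < 1 ->
  (1 - x ^ 2) * sum_n (fun k => log_weight_sum k * x ^ k) (S N)
  <= 1 + 2 * sum_n (fun k => x ^ S k / INR (S k)) N.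
Proof.
  intros Hx.
  assert (E : (1 - x ^ 2) * sum_n (fun k => log_weight_sum k * x ^ k) (S N)
    = 1 + 2 * sum_n (fun k => x ^ S k / INR (S k)) N
      - log_weight_sum N * x ^ (N + 2) - log_weight_sum (S N) * x ^ (N + 3)).
  { induction N as [|N IH].
    - rewrite Rsum_Sn, !sum_O. simpl. field.
    - rewrite (Rsum_Sn _ (S N)), Rmult_plus_distr_l, IH, (Rsum_Sn _ N), log_weight_sum_SS.
      replace (S N + 2)%nat with (N + 3)%nat by lia.
      replace (S N + 3)%nat with (S (S N) + 2)%nat by lia.
      replace (N + 2)%nat with (S (S N)) by lia.
      rewrite (pow_add x (S (S N)) 2). field. apply not_0_INR; lia. }
  rewrite E.
  assert (Hw := log_weight_sum_nonneg).
  assert (Hp : forall n, 0 <= x ^ n) by (intros; apply pow_le; lra).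
  assert (H1 := Rmult_le_pos _ _ (Hw N) (Hp (N + 2)%nat)).
  assert (H2 := Rmult_le_pos _ _ (Hw (S N)) (Hp (N + 3)%nat)). lra.
Qed.

Lemma log_weight_series_le x N : 0 <= x < 1 ->
  sum_n (fun k => log_weight_sum k * x ^ k) N <= (1 - 2 * ln (1 - x)) / (1 - x ^ 2).
Proof.
  intros Hx. apply Rle_trans with (sum_n (fun k => log_weight_sum k * x ^ k) (S N)).
  - apply sum_n_nonneg_le; [|lia]. intros k. apply Rmult_le_pos; [apply log_weight_sum_nonneg|apply pow_le; lra].
  - apply Rle_div_r; [nra|]. rewrite Rmult_comm.
    eapply Rle_trans; [now apply log_weight_partial_sum|].
    assert (H := log_partial_sum_le x N Hx). lra.
Qed.

Lemma ln_weight x : x < 1 -> ln (exp 1 / (1 - x) ^ 2) = 1 - 2 * ln (1 - x).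
Proof.
  intros Hx. rewrite ln_div; [|apply exp_pos|apply pow_lt; lra].
  rewrite ln_exp, ln_pow by lra. simpl. ring.
Qed.

Lemma ln_weight_ge_1 x : 0 <= x < 1 -> 1 <= 1 - 2 * ln (1 - x).
Proof.
  intros Hx. assert (H := log_partial_sum_le x 0 Hx). rewrite sum_O in H.
  simpl in H. lra.
Qed.

(** Coefficient by coefficient, g' is dominated by a multiple of
    (1 - 2 ln (1-x)) / (1 - x^2), which is exactly the reciprocal of the weight. *)
Lemma hilbert_derivative_bound a f beta b g z :
  power_series_on_disk a f -> derivative_bound f beta ->
  (forall n, is_series (fun k => (a k / RtoC (INR (n + k + 1)))%C) (b n)) ->
  power_series_on_disk b g -> disk z ->
  / ln (exp 1 / (1 - Cmod z) ^ 2) * ((1 - Cmod z ^ 2) * Cmod (C_derive g z))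
  <= / 2 * Cmod (a 0%nat) + (3 / 2 - ln 2) * beta.
Proof.
  intros Hf Hbeta Hb Hg Hz.
  assert (Hb0 := derivative_bound_nonneg f beta Hbeta).
  set (K := / 2 * Cmod (a 0%nat) + (3 / 2 - ln 2) * beta).
  assert (HK : 0 <= K).
  { unfold K. assert (H := ln_2_le). assert (H0 := Cmod_ge_0 (a 0%nat)). nra. }
  assert (Hx : 0 <= Cmod z < 1) by (split; [apply Cmod_ge_0|exact Hz]).
  set (x := Cmod z) in *.
  assert (Hcoef : forall n, Cmod (derived_coef b n) <= K * log_weight_sum n).
  { intros n. unfold derived_coef. rewrite Cmod_mult, Cmod_R, Rabs_pos_eq by apply pos_INR.
    assert (H1 := hilbert_coef_bound a f beta (S n) (b (S n)) Hf Hbeta (Hb (S n))).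
    assert (HS : 0 < INR (S (S n))) by (apply lt_0_INR; lia).
    assert (H2 : Cmod (b (S n)) <=
      Cmod (a 0%nat) / INR (S (S n)) + beta * (moment_sum (S n) 1 / INR (S (S n)))).
    { replace (b (S n)) with (a 0%nat / RtoC (INR (S (S n))) +
        (b (S n) - a 0%nat / RtoC (INR (S (S n)))))%C by ring.
      eapply Rle_trans; [apply Cmod_triangle|]. apply Rplus_le_compat; [|exact H1].
      rewrite Cmod_div by apply RtoC_INR_neq_0. rewrite Cmod_R, Rabs_pos_eq; lra. }
    apply Rle_trans with (INR (S n) *
      (Cmod (a 0%nat) / INR (S (S n)) + beta * (moment_sum (S n) 1 / INR (S (S n))))).
    - apply Rmult_le_compat_l; [apply pos_INR|exact H2].
    - replace (INR (S n) *
        (Cmod (a 0%nat) / INR (S (S n)) + beta * (moment_sum (S n) 1 / INR (S (S n)))))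
        with (Cmod (a 0%nat) * (INR (S n) / INR (S (S n)))
              + beta * (INR (S n) / INR (S (S n)) * moment_sum (S n) 1)) by (field; lra).
      assert (H3 := constant_part_le n). assert (H4 := bloch_part_le n).
      assert (H5 := Rmult_le_compat_l _ _ _ (Cmod_ge_0 (a 0%nat)) H3).
      assert (H6 := Rmult_le_compat_l _ _ _ Hb0 H4).
      unfold K. lra. }
  set (W := (1 - 2 * ln (1 - x)) / (1 - x ^ 2)).
  assert (Hw : forall k, 0 <= log_weight_sum k * x ^ k).
  { intros k. apply Rmult_le_pos; [apply log_weight_sum_nonneg|apply pow_le; lra]. }
  destruct (ex_series_of_bounded (fun k => log_weight_sum k * x ^ k) W Hw) as [L HL].
  { intros N. now apply log_weight_series_le. }
  assert (HLW : L <= W).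
  { apply (is_lim_seq_le (sum_n (fun k => log_weight_sum k * x ^ k)) (fun _ => W) L W).
    - intros N. now apply log_weight_series_le.
    - exact HL.
    - apply is_lim_seq_const. }
  assert (Hd : Cmod (C_derive g z) <= K * L).
  { apply (Cmod_is_series_le (fun k => (derived_coef b k * z ^ k)%C) _
             (fun k => K * (log_weight_sum k * x ^ k))).
    - apply is_pseries_C, C_derive_power_series; assumption.
    - apply (@is_series_scal R_AbsRing R_NormedModule), HL.
    - intros k. rewrite Cmod_mult, Cmod_pow. fold x. rewrite <- Rmult_assoc.
      apply Rmult_le_compat_r; [apply pow_le; lra|apply Hcoef]. }
  assert (H1 := ln_weight_ge_1 x Hx).
  rewrite ln_weight by lra.
  assert (HW : (1 - x ^ 2) * W = 1 - 2 * ln (1 - x)) by (unfold W; field; nra).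
  apply Rmult_le_reg_l with (1 - 2 * ln (1 - x)); [lra|].
  rewrite <- Rmult_assoc, Rinv_r, Rmult_1_l by lra.
  rewrite <- HW at 1. rewrite Rmult_assoc.
  apply Rmult_le_compat_l; [nra|]. nra.
Qed.

(** * The norm *)
Lemma Lub_Rbar_finite (P : R -> Prop) x0 B :
  P x0 -> (forall x, P x -> x <= B) ->
  exists l, Lub_Rbar P = Finite l /\ l <= B /\ forall x, P x -> x <= l.
Proof.
  intros H0 HB. destruct (Lub_Rbar_correct P) as [Hub Hlub].
  assert (H1 := Hub x0 H0).
  assert (H2 : Rbar_le (Lub_Rbar P) B) by (apply Hlub; intros x Hx; now apply HB).
  destruct (Lub_Rbar P) as [l| |]; simpl in H1, H2; try contradiction.
  exists l. repeat split; [exact H2|]. intros x Hx. exact (Hub x Hx).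
Qed.

Lemma disk_0 : disk (RtoC 0).
Proof. unfold disk. rewrite Cmod_0. lra. Qed.

Lemma bloch_norm_finite f :
  Rbar_lt (bloch_norm f) p_infty ->
  exists beta, derivative_bound f beta /\ bloch_norm f = Finite (Cmod (f (RtoC 0)) + beta).
Proof.
  unfold bloch_norm. intros Hf.
  set (P := fun x : R => exists z : C, disk z /\ x = (1 - Cmod z ^ 2) * Cmod (C_derive f z)) in *.
  destruct (Lub_Rbar_correct P) as [Hub _].
  assert (H0 : P ((1 - Cmod (RtoC 0) ^ 2) * Cmod (C_derive f (RtoC 0))))
    by (exists (RtoC 0); split; [apply disk_0|reflexivity]).
  apply Hub in H0.
  destruct (Lub_Rbar P) as [l| |]; simpl in H0, Hf; try contradiction.
  exists l. split; [|reflexivity]. intros z Hz. apply (Hub _). now exists z.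
Qed.

Lemma bloch_log_norm_finite g A B :
  Cmod (g (RtoC 0)) <= A ->
  (forall z, disk z ->
    / ln (exp 1 / (1 - Cmod z) ^ 2) * ((1 - Cmod z ^ 2) * Cmod (C_derive g z)) <= B) ->
  exists N, bloch_log_norm g = Finite N /\ N <= A + B /\
    Cmod (g (RtoC 0)) + Cmod (C_derive g (RtoC 0)) <= N.
Proof.
  intros HA HB. unfold bloch_log_norm.
  set (P := fun x : R => exists z : C, disk z /\ _).
  assert (H0 : P (Cmod (C_derive g (RtoC 0)))).
  { exists (RtoC 0). split; [apply disk_0|].
    rewrite Cmod_0, ln_weight by lra. rewrite Rminus_0_r, ln_1. field. }
  destruct (Lub_Rbar_finite P _ B H0) as (l & El & Hl & Hub).
  { intros x (z & Hz & ->). now apply HB. }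
  exists (Cmod (g (RtoC 0)) + l). rewrite El.
  split; [reflexivity|]. split; [lra|]. specialize (Hub _ H0). lra.
Qed.

Lemma power_series_at_0 a f : power_series_on_disk a f -> f (RtoC 0) = a 0%nat.
Proof.
  intros Hf. rewrite <- (pseries_sum_unique _ _ _ (Hf (RtoC 0) disk_0)).
  exact (pseries_sum_unique _ _ _ (@is_pseries_0 C_AbsRing C_NormedModule a)).
Qed.

(** The estimates of |g(0)| and of the weighted derivative add up to the factor 3/2 in both
    |f(0)| and beta: 1 + 1/2 for the former, ln 2 + (3/2 - ln 2) for the latter. The lower
    bound is the value of the expression at the origin. *)
Lemma hilbert_norm_le a f b g beta :
  power_series_on_disk a f -> derivative_bound f beta ->
  (forall n, is_series (fun k => (a k / RtoC (INR (n + k + 1)))%C) (b n)) ->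
  power_series_on_disk b g ->
  exists N, bloch_log_norm g = Finite N /\ N <= 3 / 2 * (Cmod (f (RtoC 0)) + beta) /\
    Cmod (b 0%nat) + Cmod (b 1%nat) <= N.
Proof.
  intros Hf Hbeta Hb Hg.
  assert (Hg0 : Cmod (g (RtoC 0)) <= Cmod (a 0%nat) + beta * ln 2).
  { rewrite (power_series_at_0 b g Hg).
    assert (H := hilbert_coef_bound a f beta 0 (b 0%nat) Hf Hbeta (Hb 0%nat)).
    simpl in H. replace (beta * (ln (1 + 1) / 1)) with (beta * ln 2) in H
      by (replace (1 + 1) with 2 by ring; field).
    replace (b 0%nat) with (a 0%nat + (b 0%nat - a 0%nat / RtoC 1))%C by field.
    eapply Rle_trans; [apply Cmod_triangle|lra]. }
  destruct (bloch_log_norm_finite g _ _ Hg0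
    (fun z Hz => hilbert_derivative_bound a f beta b g z Hf Hbeta Hb Hg Hz))
    as (N & EN & HN & HN').
  exists N. split; [exact EN|]. rewrite (power_series_at_0 a f Hf). split; [lra|].
  rewrite (power_series_at_0 b g Hg) in HN'.
  assert (E1 : C_derive g (RtoC 0) = b 1%nat).
  { rewrite <- (pseries_sum_unique _ _ _ (C_derive_power_series b g _ Hg disk_0)).
    transitivity (derived_coef b 0);
      [exact (pseries_sum_unique _ _ _ (@is_pseries_0 C_AbsRing C_NormedModule _))|].
    unfold derived_coef. simpl. ring. }
  now rewrite E1 in HN'.
Qed.

Lemma bloch_hilbert f : bloch f -> exists g, is_hilbert f g /\ bloch_log g.
Proof.
  intros [Hf Hnorm].
  destruct (analytic_power_series f Hf) as [a Ha].
  destruct (bloch_norm_finite f Hnorm) as (beta & Hbeta & _).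
  destruct (hilbert_exists a f Ha (bloch_coef_summable a f beta Ha Hbeta)) as (b & g & Hb & Hg).
  exists g. split; [now exists a, b|]. split; [now apply (power_series_analytic b)|].
  destruct (hilbert_norm_le a f b g beta Ha Hbeta Hb Hg) as (N & EN & _).
  rewrite EN. exact I.
Qed.

Lemma is_series_single (u : nat -> C) : (forall k, u (S k) = RtoC 0) -> is_series u (u 0%nat).
Proof.
  intros Hu. apply is_Cseries_eps. intros e He. exists 0%nat. intros n _.
  assert (E : sum_n u n = u 0%nat :> C).
  { induction n as [|n IH]; [apply sum_O|]. rewrite Csum_Sn, IH, Hu. ring. }
  rewrite E. replace (u 0%nat - u 0%nat)%C with (RtoC 0) by ring. now rewrite Cmod_0.
Qed.

(** The image of the constant function 1 has the coefficients 1/(n+1), so already its value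
    and derivative at the origin contribute 1 + 1/2. *)
Lemma hilbert_constant_one :
  let one := fun _ : C => RtoC 1 in
  bloch one /\ bloch_norm one = Finite 1 /\
  exists g N, is_hilbert one g /\ bloch_log_norm g = Finite N /\ 3 / 2 <= N.
Proof.
  intros one.
  set (a := fun k => match k with O => RtoC 1 | S _ => RtoC 0 end).
  assert (Ha : power_series_on_disk a one).
  { intros z _. apply is_pseries_C.
    replace (one z) with (a 0%nat * z ^ 0)%C by (change (RtoC 1 * RtoC 1 = RtoC 1)%C; ring).
    apply (is_series_single (fun k => (a k * z ^ k)%C)). intros k. change (a (S k)) with (RtoC 0). ring. }
  assert (Hd : forall z, disk z -> C_derive one z = RtoC 0).
  { intros z Hz.
    rewrite <- (pseries_sum_unique _ _ _ (C_derive_power_series a one z Ha Hz)).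
    apply CSeries_unique.
    replace (RtoC 0) with (derived_coef a 0 * z ^ 0)%C by (unfold derived_coef; simpl; ring).
    apply (is_series_single (fun k => (derived_coef a k * z ^ k)%C)).
    intros k. unfold derived_coef. change (a (S (S k))) with (RtoC 0). ring. }
  assert (Hbeta : derivative_bound one 0).
  { intros z Hz. rewrite Hd, Cmod_0 by assumption. lra. }
  assert (Hnorm : bloch_norm one = Finite 1).
  { unfold bloch_norm.
    rewrite (is_lub_Rbar_unique _ (Finite 0)).
    - unfold one. rewrite Cmod_1. simpl. now rewrite Rplus_0_r.
    - split.
      + intros x (z & Hz & ->). now apply Hbeta.
      + intros l Hl. apply (Hl 0). exists (RtoC 0). split; [apply disk_0|].
        rewrite Hd, !Cmod_0 by apply disk_0. ring. }
  split; [split; [now apply (power_series_analytic a)|now rewrite Hnorm]|].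
  split; [exact Hnorm|].
  destruct (hilbert_exists a one Ha (bloch_coef_summable a one 0 Ha Hbeta)) as (b & g & Hb & Hg).
  destruct (hilbert_norm_le a one b g 0 Ha Hbeta Hb Hg) as (N & EN & _ & HN).
  exists g, N. split; [now exists a, b|]. split; [exact EN|].
  assert (Hbn : forall n, Cmod (b n) = / INR (S n)).
  { intros n.
    rewrite (is_Cseries_unique _ _ _ (Hb n)
      (is_series_single (fun k => (a k / RtoC (INR (n + k + 1)))%C)
         ltac:(intros k; unfold a, Cdiv; ring))).
    cbv beta. replace (n + 0 + 1)%nat with (S n) by lia.
    rewrite Cmod_div by apply RtoC_INR_neq_0. unfold a.
    rewrite Cmod_1, Cmod_R, Rabs_pos_eq by apply pos_INR. unfold Rdiv; ring. }
  rewrite !Hbn in HN. simpl in HN. lra.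
Qed.

Theorem theorem3p1 :
  (forall f : C -> C, bloch f ->
     exists g : C -> C, is_hilbert f g /\ bloch_log g) /\
  hilbert_norm_bloch_bloch_log = Finite (3 / 2).
Proof.
  split; [exact bloch_hilbert|].
  unfold hilbert_norm_bloch_bloch_log. apply Rbar_is_lub_unique. split.
  - intros x (f & g & [_ Hfnorm] & _ & (a & b & Ha & Hb & Hg) & ->).
    destruct (bloch_norm_finite f Hfnorm) as (beta & Hbeta & Ef).
    destruct (hilbert_norm_le a f b g beta Ha Hbeta Hb Hg) as (N & EN & HN & HN0).
    rewrite EN, Ef. change (N / (Cmod (f (RtoC 0)) + beta) <= 3 / 2).
    assert (Hb0 := derivative_bound_nonneg f beta Hbeta).
    assert (H0 := Cmod_ge_0 (f (RtoC 0))).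
    set (F := Cmod (f (RtoC 0)) + beta) in *.
    destruct (Req_dec F 0) as [E|E].
    + (* division by zero gives zero *)
      unfold Rdiv. rewrite E, Rinv_0. lra.
    + apply Rle_div_l; [unfold F in *; lra|exact HN].
  - intros l Hl.
    destruct hilbert_constant_one as (Hone & Enorm & g & N & Hg & EN & HN).
    eapply Rbar_le_trans; [|apply Hl; exists (fun _ => RtoC 1), g; repeat split; [exact (proj1 Hone)|exact (proj2 Hone)| |exact Hg]].
    + rewrite EN, Enorm. change (3 / 2 <= N / 1). lra.
    + exists (RtoC 0). split; [apply disk_0|]. intros E. apply RtoC_inj in E. lra.
Qed.
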